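(* Let $\lambda\in(0,\infty)$, $K>0$, $\beta>2$, and let $\phi=\{X_i\}_{i\in\mathbb{N}}$ be a locally finite deterministic point pattern on $\mathbb{R}^2$ satisfying the empirical homogeneity condition $$\frac{\phi(B_0(r))}{\pi r^2}\longrightarrow\lambda\qquad(r\to\infty).$$ For $\sigma>0$ let $S_i^{(\sigma)}=\exp(-\sigma^2/2+\sigma Z_i)$, where $(Z_i)_{i\in\mathbb{N}}$ are i.i.d. standard normal random variables, let $K(\sigma)=K\exp\left(-\frac{\sigma^2(\beta-2)}{2\beta^2}\right)$, and define the point process on $\mathbb{R}^+$ $$\mathcal{N}^{(\sigma)}=\left\{\frac{K(\sigma)^\beta|X_i|^\beta}{S_i^{(\sigma)}}:X_i\in\phi\right\}.$$ Then, as $\sigma\to\infty$, $\mathcal{N}^{(\sigma)}$ converges weakly to the Poisson point process on $\mathbb{R}^+$ with intensity measure $\Lambda$ given by $$\Lambda([0,t))=\frac{\lambda\pi}{K^2}\,t^{2/\beta},\qquad t\ge 0.$$ Moreover, let $0\le a_\sigma<b_\sigma\le\infty$ satisfy, as $\sigma\to\infty$, $$\frac{\log(a_\sigma)}{\sigma^2}\to 0,\qquad \frac{\log(b_\sigma)}{\sigma^2}\to\infty.$$ Then the point process $$\bar{\mathcal{N}}^{(\sigma)}=\left\{\frac{K(\sigma)^\beta|X_i|^\beta}{S_i^{(\sigma)}}:X_i\in\phi,\ a_\sigma<|X_i|<b_\sigma\right\}$$ also converges weakly, as $\sigma\to\infty$, to the Poisson point process on $\mathbb{R}^+$ with the same intensity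 measure $\Lambda$.
   Context: $\mathbb{R}^+=[0,\infty)$. $B_0(r)$ is the ball of radius $r$ centred at the origin of $\mathbb{R}^2$, and $\phi(B)$ is the number of points of $\phi$ in $B$. Locally finite means $\phi(B)<\infty$ for every bounded $B$. Weak convergence of point processes means convergence in distribution as random elements of the space of locally finite counting measures on $\mathbb{R}^+$ with the vague topology. The convention $\log\infty=\infty$ is used, so $b_\sigma=\infty$ is allowed.
   Formalization: The convergence of the full process is stated for patterns with no point at the origin; a point at the origin would give an atom at 0 for every σ, and the first claim would then be false. *)

(* Defs.v *)
From HB Require Import structures.
From mathcomp Require Import all_boot all_order all_algebra finmap.
From mathcomp Require Import all_classical all_reals all_analysis.
From mathcomp Require Import measurable_realfun.

Set Implicit Arguments.
Unset Strict Implicit.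
Unset Printing Implicit Defensive.

Import Order.TTheory GRing.Theory Num.Theory.
Import numFieldNormedType.Exports.

Local Open Scope classical_set_scope.
Local Open Scope ring_scope.

(* Point patterns are families of points: repeated points are counted with
   multiplicity. *)
Definition point_measure {d} {T : measurableType d} (R : realType)
    (D : pred nat) (x : nat -> T) : {measure set T -> \bar R} :=
  mseries (fun i : nat => if D i then dirac (x i) : {measure set T -> \bar R}
                          else mzero) 0.

(* The library norm on [R * R] is the sup norm, whence an explicit Euclidean
   norm. *)
Definition enorm {R : realType} (x : R * R) : R :=
  Num.sqrt (x.1 ^+ 2 + x.2 ^+ 2).

Definition disk {R : realType} (r : R) : set (R * R) := [set x | enorm x < r].

Definition locally_finite_pattern {R : realType} (X : nat -> R * R) : Prop :=
  forall B : set (R * R), measurable B -> bounded_set B ->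
    (point_measure R predT X B < +oo)%E.

Definition empirically_homogeneous {R : realType} (lambda : R)
    (X : nat -> R * R) : Prop :=
  (point_measure R predT X (disk r) * ((pi * r ^+ 2)^-1)%:E)%E
    @[r --> +oo%R] --> lambda%:E.

(* The half-line [0, +oo[ is handled as a subset of the Borel space R: a measure
   on [0, +oo[ is a measure on R that does not charge ]-oo, 0[. *)
Definition is_lfcount {R : realType} (mu : {measure set R -> \bar R}) : Prop :=
  mu `]-oo, 0[%classic = 0%E /\
  forall B : set R, measurable B -> bounded_set B ->
    exists n : nat, mu B = n%:R%:E.

Record lfcount (R : realType) := Lfcount {
  lfcount_measure :> {measure set R -> \bar R};
  lfcountP : is_lfcount lfcount_measure }.

HB.instance Definition _ (R : realType) := gen_eqMixin (lfcount R).
HB.instance Definition _ (R : realType) := gen_choiceMixin (lfcount R).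

(* Continuous functions on [0, +oo[ with compact support; the values on
   ]-oo, 0[ are irrelevant. *)
Definition Cc (R : realType) := {f : R -> R |
  {within `[0, +oo[, continuous f} /\ exists M, forall x, M < x -> f x = 0}.

HB.instance Definition _ (R : realType) := gen_eqMixin (Cc R).
HB.instance Definition _ (R : realType) := gen_choiceMixin (Cc R).

Definition vague_map {R : realType} (mu : lfcount R) : {ptws Cc R -> R} :=
  fun f => \int[mu]_(x in `[0, +oo[) sval f x.

HB.instance Definition _ (R : realType) :=
  Topological.copy (lfcount R) (initial_topology (@vague_map R)).

Lemma is_lfcount0 (R : realType) :
  is_lfcount (mzero : {measure set R -> \bar R}).
Proof. by split=> // B _ _; exists 0. Qed.

(* The random measures below are only almost surely locally finite; on the
   exceptional null event they are replaced by the null measure. *)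
Definition to_lfcount {R : realType} (mu : {measure set R -> \bar R}) :
    lfcount R :=
  match pselect (is_lfcount mu) with
  | left h => Lfcount h
  | right _ => Lfcount (is_lfcount0 R)
  end.

Definition point_process {d} {Omega : measurableType d} {R : realType}
    (N : Omega -> lfcount R) : Prop :=
  forall B : set R, measurable B ->
    measurable_fun [set: Omega] (fun w => N w B).

Definition cvg_in_law {d d'} {Omega : measurableType d}
    {Omega' : measurableType d'} {R : realType}
    (P : probability Omega R) (N : R -> Omega -> lfcount R)
    (P' : probability Omega' R) (N' : Omega' -> lfcount R) : Prop :=
  forall F : lfcount R -> R, continuous F -> bounded_fun F ->
    'E_P[F \o N s]%E @[s --> +oo%R] --> 'E_P'[F \o N']%E.

(* The point probabilities are written out because [poisson_pmf 0 k] is 1 for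
   every k. *)
Definition poisson_process {d} {Omega : measurableType d} {R : realType}
    (P : probability Omega R) (N : Omega -> lfcount R)
    (Lambda : {measure set R -> \bar R}) : Prop :=
  point_process N /\
  forall (n : nat) (B : 'I_n -> set R) (k : 'I_n -> nat),
    (forall i, [/\ measurable (B i), bounded_set (B i) & B i `<=` `[0, +oo[]) ->
    trivIset [set: 'I_n] B ->
    P (\bigcap_i [set w | N w (B i) = (k i)%:R%:E]) =
      (\prod_(i < n) (fine (Lambda (B i)) ^+ k i / (k i)`!%:R
                      * expR (- fine (Lambda (B i)))))%:E.

Definition mutually_independent {d} {Omega : measurableType d} {R : realType}
    (P : probability Omega R) (Z : nat -> {RV P >-> R}) : Prop :=
  forall (J : {fset nat}) (B : nat -> set R), (forall i, measurable (B i)) ->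
    P (\bigcap_(i in [set` J]) (Z i @^-1` B i)) =
      (\prod_(i <- J) P (Z i @^-1` B i))%E.

Definition iid_standard_normal {d} {Omega : measurableType d} {R : realType}
    (P : probability Omega R) (Z : nat -> {RV P >-> R}) : Prop :=
  mutually_independent Z /\
  forall i (B : set R), measurable B ->
    distribution P (Z i) B = normal_prob 0 1 B.

Definition shadowing {R : realType} (sigma z : R) : R :=
  expR (- (sigma ^+ 2 / 2) + sigma * z).

Definition Ksigma {R : realType} (K beta sigma : R) : R :=
  K * expR (- (sigma ^+ 2 * (beta - 2) / (2 * beta ^+ 2))).

Definition propagation {R : realType} (K beta sigma : R) (x : R * R) (z : R) :
    R :=
  Ksigma K beta sigma `^ beta * enorm x `^ beta / shadowing sigma z.

Definition propagation_measure {R : realType} (K beta sigma : R)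
    (D : pred (R * R)) (X : nat -> R * R) (z : nat -> R) :
    {measure set R -> \bar R} :=
  point_measure R (fun i => D (X i))
    (fun i => propagation K beta sigma (X i) (z i)).

Definition propagation_process {d} {Omega : measurableType d} {R : realType}
    (P : probability Omega R) (K beta : R) (D : R -> pred (R * R))
    (X : nat -> R * R) (Z : nat -> {RV P >-> R}) (sigma : R) (w : Omega) :
    lfcount R :=
  to_lfcount (propagation_measure K beta sigma (D sigma) X (fun i => Z i w)).

Definition annulus {R : realType} (a : R -> R) (b : R -> \bar R) (sigma : R) :
    pred (R * R) :=
  fun x => ((a sigma)%:E < (enorm x)%:E < b sigma)%E.

(* Main.v *)
Require Import Defs.
From HB Require Import structures.
From mathcomp Require Import all_boot all_order all_algebra finmap.
From mathcomp Require Import all_classical all_reals all_analysis.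
From mathcomp Require Import measurable_realfun.
From mathcomp Require Import ring lra.

Set Implicit Arguments.
Unset Strict Implicit.
Unset Printing Implicit Defensive.

Import Order.TTheory GRing.Theory Num.Theory.
Import numFieldNormedType.Exports.

Local Open Scope classical_set_scope.
Local Open Scope ring_scope.

(** Let rho_t(z) = t^(1/beta) / K * exp (sigma z / beta - sigma^2 / beta^2). The
    i-th point of the process lies below t exactly when |X_i| < rho_t(Z_i), so
    the expected number of points below t is E[phi(B_0(rho_t(Z)))] for a
    standard normal Z. Up to a constant factor rho_t(Z)^2 is the likelihood
    ratio of N(2 sigma / beta, 1) with respect to N(0, 1); under the tilted law
    log (rho_t(Z)) / sigma^2 concentrates at 1 / beta^2 > 0, where the empirical
    homogeneity applies and where the radii a and b do not matter. Hence the
    mean measures converge to Lambda. The points form a null array of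
    independent points, so the counts in finitely many disjoint cells converge
    to independent Poisson variables: up to the maximal hitting probability,
    their pmf satisfies the recursion k_j pi(k) = Lambda_j pi(k - e_j).

    To pass to a vaguely continuous bounded F >= 0, let F_n(mu) be the infimum
    of F over the measures with the same counts as mu on the dyadic cells of
    level n. Then F_n <= F, F_n -> F pointwise by continuity, and F_n only
    depends on finitely many integers, so that
    liminf E F(N_s) >= lim E F_n(N_s) = E F_n(N), which tends to E F(N); apply
    this to F + M and M - F. No tightness argument is needed. *)

(** * Vague topology and dyadic cell counts *)

(** A pattern point at the origin is sent to 0 whatever its shadowing: it would leave a fixed atom
    at 0 for every sigma and spoil the Poisson limit. Hence both convergence arguments run on
    retained points different from (0, 0); for the annulus this follows from 0 <= a_sigma < |X_i|.
    Local finiteness then leaves a gap r0 > 0 around the origin, with two uses. It gives phi(B_0(r))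
    <= B r^2 for all r > 0, so the ratio left after tilting is bounded and only its values near the
    tilted mean matter. It also makes the hitting probabilities uniformly small, since reaching
    beyond r0 forces Z > sigma / (2 beta) for large sigma. The correction in K(sigma) is what turns
    rho_t(Z)^2 into exactly t^(2/beta) / K^2 times a likelihood ratio, so no normalisation is left
    over. A function of finitely many integers still takes infinitely many values. The counts are
    therefore also capped at some L; the level n and the cap L are chosen from the limit law
    alone. *)

Lemma near_half_expn (R : realType) (e : R) : 0 < e ->
  \forall n \near \oo, 2^-1 ^+ n <= e :> R.
Proof.
move=> e0; have /cvgrPdist_le/(_ _ e0) : 2^-1 ^+ n @[n --> \oo] --> (0 : R).
  by apply: cvg_expr; rewrite ger0_norm ?invr_ge0// invf_lt1 ?ltr1n.
by apply: filterS => n; rewrite sub0r normrN ger0_norm// exprn_ge0 ?invr_ge0.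
Qed.

(** Heine-Cantor in near-covering form: each x of the compact [0, T] comes with a radius and a rank
    n that control the oscillation nearby, and compactness extracts one n for all. *)
Lemma within_unif_continuous (R : realType) (f : R -> R) (T e : R) :
  {within `[0, +oo[, continuous f} -> 0 < e ->
  \forall n \near \oo, forall x y, 0 <= x <= T -> 0 <= y ->
    `|x - y| <= 2^-1 ^+ n -> `|f x - f y| <= e.
Proof.
move=> cf e0.
have e20 : 0 < e / 2 by rewrite divr_gt0.
suff : \forall n \near \oo, `[0, T] `<=` [set x | 0 <= x -> forall y, 0 <= y ->
    `|x - y| <= 2^-1 ^+ n -> `|f x - f y| <= e].
  by apply: filterS => n h x y x0T; apply: h; rewrite /= ?in_itv//; case/andP: x0T.
have /compact_near_coveringP := @segment_compact R 0 T.
apply => x; rewrite /= in_itv/= => /andP[x0 xT].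
have /subspace_continuousP/(_ x) := cf.
rewrite /= in_itv/= andbT => /(_ x0)/cvgrPdist_le/(_ _ e20).
rewrite near_withinE => /nbhs_ballP[r /= r0 fr].
have r20 : 0 < r / 2 by rewrite divr_gt0.
(* With z within r/2 of x and y within r/2 of z, both lie in the ball where f is e/2-close to f
   x. *)
exists (ball x (r/2) , [set n | 2^-1 ^+ n < r / 2]) => /=.
  split; first exact: nbhsx_ballx.
  have r40 : 0 < r / 4 by rewrite divr_gt0.
  apply: filterS (near_half_expn r40) => n /= h; lra.
move=> [z n] /= [xz nr] z0 y y0 zy.
have h w : 0 <= w -> `|x - w| < r -> `|f x - f w| <= e / 2.
  by move=> w0 xw; apply: fr => //=; rewrite in_itv/= w0.
rewrite (_ : f z - f y = (f x - f y) - (f x - f z)); last ring.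
rewrite (le_trans (ler_normB _ _))// [leRHS]splitr lerD// h//.
  rewrite (_ : x - y = (x - z) + (z - y)); last ring.
  by rewrite (le_lt_trans (ler_normD _ _))// [ltRHS]splitr ltr_leD// (le_trans zy)// ltW.
move: xz; rewrite /ball/= => xz; apply: lt_trans xz _; lra.
Qed.

Definition cell {R : realType} (n j : nat) : set R :=
  `[j%:R * 2^-1 ^+ n, j.+1%:R * 2^-1 ^+ n[.

Lemma measurable_cell (R : realType) n j : measurable (cell n j : set R).
Proof. exact: measurable_itv. Qed.

Lemma bounded_itvco (R : realType) (a b : R) : bounded_set (`[a, b[%classic : set R).
Proof.
exists (`|a| + `|b|); split; first exact: num_real.
move=> M abM x /=; rewrite in_itv/= => /andP[ax xb].
apply: le_trans (ltW abM).
have := ler_norm b; have := ler_norm (-a); rewrite normrN ler_norml => ? ?.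
have := normr_ge0 a; have := normr_ge0 b; lra.
Qed.

Lemma cell_subset (R : realType) n j : cell n j `<=` (`[0, +oo[ : set R).
Proof.
move=> x; rewrite /cell/= !in_itv/= andbT => /andP[ax _]; apply: (le_trans _ ax).
by rewrite mulr_ge0// exprn_ge0// invr_ge0.
Qed.

Lemma cell_bounds (R : realType) n j :
  0 <= (j%:R * 2^-1 ^+ n : R) <= j.+1%:R * 2^-1 ^+ n.
Proof.
have h : 0 <= 2^-1 ^+ n :> R by rewrite exprn_ge0// invr_ge0.
by rewrite mulr_ge0//= ler_wpM2r// ler_nat.
Qed.

Lemma trivIset_cell (R : realType) n m :
  trivIset setT (fun j : 'I_m => cell n (nat_of_ord j) : set R).
Proof.
have h : 0 < 2^-1 ^+ n :> R by rewrite exprn_gt0// invr_gt0.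
have le i j (x : R) : cell n i x -> cell n j x -> (i <= j)%N.
  rewrite /cell/= !in_itv/= => /andP[ix _] /andP[_ xj].
  by have := le_lt_trans ix xj; rewrite ltr_pM2r// ltr_nat ltnS.
move=> i j _ _ [x [ix jx]]; apply: val_inj; apply/eqP.
by rewrite eqn_leq (le _ _ _ ix jx) (le _ _ _ jx ix).
Qed.

Section cell_integral.
Variables (R : realType) (mu : lfcount R) (f : R -> R).
Hypothesis cf : {within `[0, +oo[, continuous f}.

Lemma lfcount_fin_num (B : set R) : measurable B -> bounded_set B ->
  mu B \is a fin_num.
Proof. by move=> mB bB; have [_ /(_ B mB bB)[n ->]] := lfcountP mu. Qed.

Lemma lfcount_integrable (a b : R) : 0 <= a ->
  mu.-integrable `[a, b[ (EFin \o f).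
Proof.
move=> a0.
have [M fM] : exists M, forall x, `[a, b]%classic x -> `|f x| <= M.
  have sub : `[a, b] `<=` (`[0, +oo[ : set R).
    by move=> x /=; rewrite !in_itv/= andbT => /andP[ax _]; exact: (le_trans _ ax).
  have := continuous_compact (continuous_subspaceW sub cf) (@segment_compact R a b).
  move=> /compact_bounded[M [_ /(_ (M + 1))]]; rewrite ltrDl ltr01 => /(_ isT) h.
  by exists (M + 1) => x xab; apply: h; exists x.
have sub : `[a, b[ `<=` (`[0, +oo[ : set R).
  by move=> x /=; rewrite !in_itv/= andbT => /andP[ax _]; exact: (le_trans _ ax).
apply: (@measurable_bounded_integrable _ _ _ mu) => //.
- by rewrite ltey_eq lfcount_fin_num//; exact: bounded_itvco.
- apply: (measurable_funS _ sub) => //.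
  by apply: subspace_continuous_measurable_fun.
- exists M; split; first exact: num_real.
  move=> N MN x /= xab; apply: le_trans (ltW MN); apply: fM.
  by move: xab; rewrite /= !in_itv/= => /andP[-> /ltW].
Qed.

Lemma cell_Rintegral n j e :
  (forall x, cell n j x -> `|f x - f (j%:R * 2^-1 ^+ n)| <= e) ->
  `|\int[mu]_(x in cell n j) f x - f (j%:R * 2^-1 ^+ n) * fine (mu (cell n j))|
    <= e * fine (mu (cell n j)).
Proof.
move=> h; have h0 : 0 <= j%:R * 2^-1 ^+ n :> R by rewrite mulr_ge0// exprn_ge0// invr_ge0.
have If : mu.-integrable (cell n j) (EFin \o f) by exact: lfcount_integrable.
have fc : (mu (cell n j) < +oo)%E.
  by rewrite ltey_eq lfcount_fin_num//; [exact: measurable_cell|exact: bounded_itvco].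
have Ic c : mu.-integrable (cell n j) (EFin \o (fun=> c)).
  apply: measurable_bounded_integrable => //; first exact: measurable_cell.
  by exists `|c|; split; [exact: num_real|move=> M cM x _; exact: ltW].
rewrite -Rintegral_cst; last exact: measurable_cell.
rewrite -RintegralB//; last exact: measurable_cell.
have Id : mu.-integrable (cell n j) (EFin \o (fun t => f t - f (j%:R * 2^-1 ^+ n))).
  exact: (integrableB (measurable_cell _ _) If (Ic (f (j%:R * 2^-1 ^+ n)))).
rewrite (le_trans (le_normr_Rintegral _ _))//; first exact: measurable_cell.
rewrite -Rintegral_cst; last exact: measurable_cell.
apply: le_Rintegral => //; first exact: measurable_cell.
exact: integrable_abse Id.
Qed.

(** The Riemann sum sees mu only through its cell counts, so measures with equal counts have close
    integrals. *)
Lemma Rintegral_cells n J e :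
  (forall j x, (j < J)%N -> cell n j x -> `|f x - f (j%:R * 2^-1 ^+ n)| <= e) ->
  `|\int[mu]_(x in `[0, J%:R * 2^-1 ^+ n[) f x -
    \sum_(j < J) f (j%:R * 2^-1 ^+ n) * fine (mu (cell n j))|
    <= e * \sum_(j < J) fine (mu (cell n j)).
Proof.
elim: J => [|J IH] h.
  by rewrite !big_ord0 mul0r set_itvco0 Rintegral_set0 mulr0 subr0 normr0.
have h0 k : 0 <= k%:R * 2^-1 ^+ n :> R by rewrite mulr_ge0// exprn_ge0// invr_ge0.
have hJ : J%:R * 2^-1 ^+ n <= J.+1%:R * 2^-1 ^+ n :> R.
  by rewrite ler_wpM2r// ?ler_nat// exprn_ge0// invr_ge0.
have -> : `[0, J.+1%:R * 2^-1 ^+ n[%classic =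
    `[0, J%:R * 2^-1 ^+ n[%classic `|` cell n J :> set R.
  by rewrite /cell -itv_bndbnd_setU// bnd_simp.
rewrite Rintegral_setU//; last 3 first.
- exact: measurable_cell.
- rewrite /cell -itv_bndbnd_setU ?bnd_simp//; exact: lfcount_integrable.
- rewrite disj_set2E/cell; apply/eqP/seteqP; split => x //= [] .
  by rewrite !in_itv/= => /andP[_ xJ] /andP[/le_lt_trans/(_ xJ)]; rewrite ltxx.
rewrite !big_ord_recr/= mulrDr opprD addrACA.
apply: le_trans (ler_normD _ _) _; apply: lerD.
  by apply: IH => j x jJ; apply: h; rewrite ltnS ltnW.
by apply: cell_Rintegral => x; exact: h.
Qed.

Lemma lfcount_vanish_Rintegral (M : R) : 0 <= M -> (forall x, M <= x -> f x = 0) ->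
  \int[mu]_(x in `[0, +oo[) f x = \int[mu]_(x in `[0, M[) f x.
Proof.
move=> M0 fM; rewrite [RHS]Rintegral_mkcond [LHS]Rintegral_mkcond.
congr (Rintegral _ _); apply/funext => x; rewrite !patchE !mem_setE !in_itv/= andbT.
by have [xM|/fM ->] := ltP x M; rewrite ?andbT ?andbF//; case: ifP.
Qed.

End cell_integral.

(** The first n * 2 ^ n cells of level n fill [0, n[: a single index refines the mesh and enlarges
    the window. *)
Definition same_cells {R : realType} (n : nat) (mu nu : lfcount R) :=
  forall j, (j < n * 2 ^ n)%N -> mu (cell n j) = nu (cell n j).

(** Both integrals are close to the same Riemann sum. The error is governed by the mass of [0, T[,
    which equal counts force to agree for mu and nu; hence the rank n is uniform over nu. *)
Lemma same_cells_Rintegral (R : realType) (mu : lfcount R) (f : Cc R) (e : R) :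
  0 < e ->
  \forall n \near \oo, forall nu, same_cells n mu nu ->
    `|vague_map mu f - vague_map nu f| <= e.
Proof.
case: f => f /= [cf [M fM]] e0; rewrite /vague_map/=.
(* An integer end point makes [0, T[ a union of dyadic cells at every level. *)
pose T := (Num.truncn `|M|).+1.
have MT : M < T%:R.
  by apply: le_lt_trans (ler_norm _) _; exact: truncnS_gt.
have fT x : T%:R <= x -> f x = 0 by move=> Tx; apply: fM; exact: lt_le_trans Tx.
pose C := fine (mu `[0, T%:R[%classic).
have C0 : 0 <= C by exact: fine_ge0.
(* Two Riemann errors e' * C must add up to at most e; the + 1 covers C = 0. *)
pose e' := e / (2 * (C + 1)).
have e'0 : 0 < e' by rewrite divr_gt0// mulr_gt0// ltr_wpDl.
have := within_unif_continuous T%:R cf e'0.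
apply: filterS2 (nbhs_infty_ge T) => n /= Tn hn nu same.
pose J := (T * 2 ^ n)%N.
have TJ : T%:R = J%:R * 2^-1 ^+ n :> R.
  by rewrite /J natrM natrX -mulrA -exprMn divff// expr1n mulr1.
have cellT j x : (j < J)%N -> cell n j x -> `|f x - f (j%:R * 2^-1 ^+ n)| <= e'.
  move=> jJ; rewrite /cell/= in_itv/= => /andP[jx xj].
  have j0 : 0 <= j%:R * 2^-1 ^+ n :> R by rewrite mulr_ge0// exprn_ge0// invr_ge0.
  apply: hn => //.
    rewrite (le_trans j0)//= ltW//; apply: lt_le_trans xj _.
    by rewrite TJ ler_wpM2r ?ler_nat// exprn_ge0// invr_ge0.
  rewrite ger0_norm ?subr_ge0// lerBlDl; apply: ltW; apply: lt_le_trans xj _.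
  by rewrite -natr1 mulrDl mul1r.
have JnN : (J <= n * 2 ^ n)%N by rewrite leq_mul2r Tn orbT.
(* The constant function 1 has oscillation 0, so its Riemann sum is exactly the mass of [0, T[. *)
have sumE : \sum_(j < J) fine (mu (cell n j)) = C.
  have c1 : {within `[0, +oo[, continuous (cst 1 : R -> R)} by move=> x; exact: cvg_cst.
  have := @Rintegral_cells _ mu _ c1 n J 0.
  rewrite mul0r normr_le0 subr_eq0 Rintegral_cst// mul1r -TJ.
  under eq_bigr do rewrite mul1r.
  by move=> /(_ _)/eqP <- // j x _ _; rewrite subrr normr0.
have H1 := Rintegral_cells mu cf cellT.
have := Rintegral_cells nu cf cellT.
rewrite -TJ sumE in H1; rewrite -TJ.
under eq_bigr => j _.
  rewrite -same; last exact: leq_trans (ltn_ord j) JnN. over.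
under [in leRHS]eq_bigr => j _.
  rewrite -same; last exact: leq_trans (ltn_ord j) JnN. over.
rewrite sumE => H2.
rewrite !(lfcount_vanish_Rintegral _ (M:=T%:R))//.
set S := \sum_(_ < _) _ in H1 H2.
set A := Rintegral _ _ _ in H1 *; set B := Rintegral _ _ _ in H2 *.
rewrite (_ : A - B = (A - S) - (B - S)); last ring.
apply: le_trans (ler_normB _ _) _.
apply: le_trans (lerD H1 H2) _.
rewrite -mulr2n -mulr_natr /e' -!mulrA ler_piMr ?(ltW e0)//.
have C1 : 0 < C + 1 by rewrite ltr_wpDl.
rewrite mulrC ler_pdivrMr ?mulr_gt0// mul1r; lra.
Qed.

Lemma same_cells_continuous (R : realType) (F : lfcount R -> R) (mu : lfcount R)
    (e : R) : continuous F -> 0 < e ->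
  \forall n \near \oo, forall nu, same_cells n mu nu -> `|F mu - F nu| <= e.
Proof.
move=> /(_ mu)/cvgrPdist_le/(_ _) cF e0; have := cF e e0.
rewrite nbhsE => -[U [[V oV <-] Vmu] UF].
(* Sets that contain the image of the class [same_cells n mu] for all large n. Vague neighbourhoods
   are preimages of open sets of the product, so it suffices that G converges to [vague_map mu],
   which is checked one test function at a time. *)
pose G : set_system {ptws Cc R -> R} :=
  [set W | \forall n \near \oo, forall nu, same_cells n mu nu -> W (vague_map nu)].
have FG : Filter G.
  split.
  - by apply: nearW => n nu.
  - move=> A B [N _ hA] [M _ hB]; exists (maxn N M) => // n /=.
    by rewrite geq_max => /andP[Nn Mn] nu s; split; [exact: (hA n)|exact: (hB n)].
  - by move=> A B AB [N _ hA]; exists N => // n Nn nu s; apply: AB; exact: (hA n).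
suff : G --> vague_map mu.
  move=> /(_ V)[]; first exact: open_nbhs_nbhs.
  by move=> N _ hN; exists N => // n Nn nu s; apply: UF; exact: (hN n Nn nu s).
apply/cvg_sup => f; rewrite cvg_image; last first.
  by rewrite eqEsubset; split=> v // _; exists (cst v).
suff H : (fun g : {ptws Cc R -> R} => g f) @ G --> vague_map mu f.
  move=> W /H GW; exists ((fun g : {ptws Cc R -> R} => g f) @^-1` W) => //.
  by rewrite eqEsubset; split => [_ [g ? <-//]|r Wr]; exists (fun=> r).
apply/cvgrPdist_le => d d0.
apply: filterS (same_cells_Rintegral mu f d0) => n h nu s; exact: h.
Qed.

(** * Lower approximations of a continuous function by functions of the cell counts *)

Definition cell_counts {R : realType} (n : nat) (mu : lfcount R) :
    {ffun 'I_(n * 2 ^ n) -> nat} :=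
  [ffun j => Num.truncn (fine (mu (cell n (nat_of_ord j))))].

Lemma cell_countsP (R : realType) n (mu : lfcount R) (j : 'I_(n * 2 ^ n)) :
  mu (cell n j) = (cell_counts n mu j)%:R%:E.
Proof.
rewrite ffunE; have [_ /(_ (cell n j))[]] := lfcountP mu.
- exact: measurable_cell.
- exact: bounded_itvco.
- by move=> k ->; rewrite /= truncnK ?natr_nat.
Qed.

Lemma cell_countsE (R : realType) n (mu : lfcount R) (k : {ffun 'I_(n * 2 ^ n) -> nat}) :
  cell_counts n mu = k <-> forall j : 'I_(n * 2 ^ n), mu (cell n j) = (k j)%:R%:E.
Proof.
split=> [<- j|h]; first exact: cell_countsP.
apply/ffunP => j; apply/eqP; rewrite -(eqr_nat R); apply/eqP/EFin_inj.
by rewrite -cell_countsP h.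
Qed.

Lemma same_cellsP (R : realType) n (mu nu : lfcount R) :
  same_cells n mu nu <-> cell_counts n nu = cell_counts n mu.
Proof.
split=> [h|h j jn].
  by apply/cell_countsE => j; rewrite -h// cell_countsP.
have := cell_countsP nu (Ordinal jn); have := cell_countsP mu (Ordinal jn).
by rewrite /= h => -> ->.
Qed.

(** The function F_n of the overview, read as a function of the count vector alone. *)
Definition cell_inf {R : realType} (F : lfcount R -> R) n
    (k : {ffun 'I_(n * 2 ^ n) -> nat}) : R :=
  inf [set F nu | nu in [set nu | cell_counts n nu = k]].

Section cell_inf.
Variables (R : realType) (F : lfcount R -> R).
Hypothesis F0 : forall mu, 0 <= F mu.
Hypothesis cF : continuous F.

Lemma cell_inf_ge0 n (k : {ffun 'I_(n * 2 ^ n) -> nat}) : 0 <= cell_inf F k.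
Proof.
rewrite /cell_inf; set A := image _ _.
(* The infimum of the empty set is 0 by convention. *)
have [->|/set0P A0] := eqVneq A set0; first by rewrite inf0.
by apply: lb_le_inf => // _ [mu _ <-].
Qed.

Lemma cell_inf_le n mu : cell_inf F (cell_counts n mu) <= F mu.
Proof.
apply: ge_inf; last by exists mu.
by exists 0 => _ [nu _ <-].
Qed.

Lemma cvg_cell_inf mu : cell_inf F (cell_counts n mu) @[n --> \oo] --> F mu.
Proof.
apply/cvgrPdist_le => e e0.
apply: filterS (same_cells_continuous mu cF e0) => n h.
rewrite ger0_norm ?subr_ge0 ?cell_inf_le// lerBlDr addrC -lerBlDr.
apply: lb_le_inf; first by exists (F mu), mu.
move=> _ [nu /= /same_cellsP/h + <-]; rewrite ler_norml => /andP[_]; lra.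
Qed.

Definition lift_ffun m L (k : {ffun 'I_m -> 'I_L}) : {ffun 'I_m -> nat} :=
  [ffun j => nat_of_ord (k j)].

(** Count vectors with an entry at least L get the value 0, which stays below F because F >= 0. What
    remains is a finite combination of indicators of count events: it is measurable, and its
    expectation is a finite combination of count probabilities. *)
Definition capped_inf n L (mu : lfcount R) : R :=
  \sum_(k : {ffun 'I_(n * 2 ^ n) -> 'I_L})
    cell_inf F (lift_ffun k) * (cell_counts n mu == lift_ffun k)%:R.

Lemma capped_inf_ge0 n L mu : 0 <= capped_inf n L mu.
Proof. by apply: sumr_ge0 => k _; rewrite mulr_ge0// cell_inf_ge0. Qed.

Lemma capped_infE n L mu : (forall j, cell_counts n mu j < L)%N ->
  capped_inf n L mu = cell_inf F (cell_counts n mu).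
Proof.
move=> h; have kE : lift_ffun [ffun j => Ordinal (h j)] = cell_counts n mu.
  by apply/ffunP => j; rewrite !ffunE.
rewrite /capped_inf (bigD1 [ffun j => Ordinal (h j)])//= kE eqxx mulr1.
rewrite big1 ?addr0// => k kn; case: eqP => [e|]; last by rewrite mulr0.
case/eqP: kn; apply/ffunP => j; apply: val_inj; rewrite ffunE/= e.
by rewrite ffunE.
Qed.

Lemma capped_inf_le n L mu : capped_inf n L mu <= cell_inf F (cell_counts n mu).
Proof.
have [h|/existsNP[j /negP hj]] := pselect (forall j, cell_counts n mu j < L)%N.
  by rewrite capped_infE.
rewrite /capped_inf big1 ?cell_inf_ge0// => k _.
case: eqP => [e|]; last by rewrite mulr0.
by move: hj; rewrite e ffunE ltn_ord.
Qed.

Lemma cvg_capped_inf n mu :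
  capped_inf n L mu @[L --> \oo] --> cell_inf F (cell_counts n mu).
Proof.
apply: cvg_near_cst; exists (\max_j cell_counts n mu j).+1 => // L /= hL.
by apply: capped_infE => j; apply: leq_trans hL; rewrite ltnS leq_bigmax.
Qed.

Section process.
Variables (d : measure_display) (Om : measurableType d) (P : probability Om R).
Variable N : Om -> lfcount R.
Hypothesis ppN : point_process N.

Lemma measurable_cell_counts n (k : {ffun 'I_(n * 2 ^ n) -> nat}) :
  measurable [set w | cell_counts n (N w) = k].
Proof.
rewrite (_ : [set w | _] = \bigcap_(j in [set: 'I_(n * 2 ^ n)])
    [set w | N w (cell n j) = (k j)%:R%:E]); last first.
  apply/seteqP; split => w /=.
    by move=> /cell_countsE h j _; exact: h.
  by move=> h; apply/cell_countsE => j; exact: h.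
apply: fin_bigcap_measurable => [|j _]; first exact: finite_finset.
rewrite -[X in measurable X]setTI.
exact: (ppN (measurable_cell n j) measurableT (emeasurable_set1 _)).
Qed.

Lemma measurable_capped_inf n L : measurable_fun setT (fun w => capped_inf n L (N w)).
Proof.
apply: measurable_sum => k; apply: measurable_funM => //.
rewrite (_ : (fun w => _) = \1_[set w | cell_counts n (N w) = lift_ffun k]).
  exact: measurable_indic (measurable_cell_counts _).
by apply/funext => w; rewrite indicE; congr (nat_of_bool _)%:R; apply/eqP/idP; rewrite inE.
Qed.

Lemma measurable_cell_inf n : measurable_fun setT (fun w => cell_inf F (cell_counts n (N w))).
Proof.
apply: (@measurable_fun_cvg _ _ _ _ (fun L w => capped_inf n L (N w))).
  by move=> L; exact: measurable_capped_inf.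
by move=> w _; exact: cvg_capped_inf.
Qed.

(** Obtained without a Borel sigma-algebra on [lfcount]: F o N is a double pointwise limit of
    functions of the counts, and the counts of a point process are measurable. *)
Lemma measurable_continuous_lfcount : measurable_fun setT (F \o N).
Proof.
apply: (@measurable_fun_cvg _ _ _ _ (fun n w => cell_inf F (cell_counts n (N w)))).
  by move=> n; exact: measurable_cell_inf.
by move=> w _; exact: cvg_cell_inf.
Qed.

Lemma expectation_capped_inf n L :
  'E_P[(fun w => capped_inf n L (N w))]%E =
  (\sum_(k : {ffun 'I_(n * 2 ^ n) -> 'I_L}) cell_inf F (lift_ffun k) *
    fine (P [set w | cell_counts n (N w) = lift_ffun k]))%:E.
Proof.
rewrite unlock.
under eq_integral do rewrite /capped_inf -sumEFin.
have mi (k : {ffun 'I_(n * 2 ^ n) -> 'I_L}) : measurable_fun setT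
    (\1_[set w | cell_counts n (N w) = lift_ffun k] : Om -> R).
  exact: measurable_indic (measurable_cell_counts _).
have iE (k : {ffun 'I_(n * 2 ^ n) -> 'I_L}) w : (cell_counts n (N w) == lift_ffun k)%:R =
   \1_[set w | cell_counts n (N w) = lift_ffun k] w :> R.
  by rewrite indicE; congr (nat_of_bool _)%:R; apply/eqP/idP; rewrite inE.
under eq_integral do under eq_bigr do rewrite iE.
rewrite ge0_integral_sum//; last 2 first.
- by move=> k; apply/measurable_EFinP; apply: measurable_funM.
- by move=> k w _; rewrite lee_fin mulr_ge0// cell_inf_ge0.
rewrite -sumEFin; apply: eq_bigr => k _.
under eq_integral do rewrite EFinM.
rewrite ge0_integralZl//; last 2 first.
- exact/measurable_EFinP.
- by rewrite lee_fin cell_inf_ge0.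
rewrite integral_indic//; last exact: measurable_cell_counts.
by rewrite setIT EFinM fineK// fin_num_measure//; exact: measurable_cell_counts.
Qed.

End process.
End cell_inf.

(** * From convergence of the cell counts to convergence in law *)

Lemma expectation_pointwise_lim (R : realType) (d : measure_display)
    (Om : measurableType d) (P : probability Om R) (f : (Om -> R)^nat) (g : Om -> R)
    (M e : R) :
  (forall n, measurable_fun setT (f n)) -> (forall n w, 0 <= f n w <= M) ->
  (forall w, f ^~ w @ \oo --> g w) -> 0 < e ->
  exists n, ('E_P[g] <= 'E_P[f n] + e%:E)%E.
Proof.
move=> mf fM fg e0; rewrite unlock.
have mg : measurable_fun setT g by apply: measurable_fun_cvg mf _ => w _; exact: fg.
have [|||||ig _ /= cv] := @dominated_convergence _ _ _ P setT measurableT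
  (fun n w => (f n w)%:E) (EFin \o g) (cst M%:E).
- by move=> n; exact/measurable_EFinP.
- exact/measurable_EFinP.
- by apply/aeW => w _; apply: cvg_EFin; [exact: nearW|exact: fg].
- exact: finite_measure_integrable_cst.
- by apply/aeW => w n _; have /andP[f0 f1] := fM n w; rewrite /= lee_fin ger0_norm.
have gfin := integrable_fin_num measurableT ig.
apply: contrapT => /forallNP H.
have : (\int[P]_x (g x)%:E + e%:E <= \int[P]_x (g x)%:E)%E.
  apply: cvge_le (cvgeD _ cv (cvg_cst e%:E)); last exact: fin_num_adde_defl.
  by apply: nearW => n; rewrite /= ltW// ltNge; apply/negP; exact: H.
by rewrite -(fineK gfin) -EFinD lee_fin gerDl leNgt e0.
Qed.

(** A third of e pays for the level n, a third for the cap L, both under the law of N', and a third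
    for the convergence of finitely many probabilities. Returning from the capped function to F
    under N s is free, because it lies below F. *)
Lemma liminf_expectation (R : realType) (d d' : measure_display)
    (Om : measurableType d) (Om' : measurableType d')
    (P : probability Om R) (P' : probability Om' R)
    (N : R -> Om -> lfcount R) (N' : Om' -> lfcount R) (F : lfcount R -> R) (M e : R) :
  (\forall s \near +oo, point_process (N s)) -> point_process N' ->
  (forall n (k : {ffun 'I_(n * 2 ^ n) -> nat}),
    fine (P [set w | cell_counts n (N s w) = k]) @[s --> +oo] -->
    fine (P' [set w | cell_counts n (N' w) = k])) ->
  (forall mu, 0 <= F mu <= M) -> continuous F -> 0 < e ->
  \forall s \near +oo, ('E_P'[F \o N'] <= 'E_P[F \o N s] + e%:E)%E.
Proof.
move=> ppN ppN' cvN F0M cF e0.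
have F0 mu : 0 <= F mu by case/andP: (F0M mu).
have FM mu : F mu <= M by case/andP: (F0M mu).
have e30 : 0 < e / 3 by rewrite divr_gt0.
have [n hn] : exists n, ('E_P'[F \o N'] <=
    'E_P'[(fun w => cell_inf F (cell_counts n (N' w)))] + (e / 3)%:E)%E.
  apply: (@expectation_pointwise_lim _ _ _ _ _ _ M) => //.
  - by move=> n; exact: measurable_cell_inf.
  - by move=> n w; rewrite cell_inf_ge0//= (le_trans (cell_inf_le _ _ _)).
  - by move=> w; exact: cvg_cell_inf.
have [L hL] : exists L, ('E_P'[(fun w => cell_inf F (cell_counts n (N' w)))] <=
    'E_P'[(fun w => capped_inf F n L (N' w))] + (e / 3)%:E)%E.
  apply: (@expectation_pointwise_lim _ _ _ _ _ _ M) => //.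
  - by move=> L; exact: measurable_capped_inf.
  - move=> L w; rewrite capped_inf_ge0//=.
    by rewrite (le_trans (capped_inf_le _ _ _ _))// (le_trans (cell_inf_le _ _ _)).
  - by move=> w; exact: cvg_capped_inf.
have : \forall s \near +oo, ('E_P'[(fun w => capped_inf F n L (N' w))] <=
    'E_P[(fun w => capped_inf F n L (N s w))] + (e / 3)%:E)%E.
  have : (\sum_(k : {ffun 'I_(n * 2 ^ n) -> 'I_L}) cell_inf F (lift_ffun k) *
      fine (P [set w | cell_counts n (N s w) = lift_ffun k])) @[s --> +oo] -->
    \sum_(k : {ffun 'I_(n * 2 ^ n) -> 'I_L}) cell_inf F (lift_ffun k) *
      fine (P' [set w | cell_counts n (N' w) = lift_ffun k]).
    apply: cvg_big; first exact: add_continuous.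
    by move=> k _; apply: cvgMl_tmp; exact: cvN.
  move=> /cvgrPdist_le/(_ _ e30).
  apply: filterS2 ppN => s ppNs; rewrite !expectation_capped_inf//.
  by rewrite -EFinD lee_fin ler_norml => /andP[_]; rewrite lerBlDl.
apply: filterS2 ppN => s ppNs hs.
apply: (le_trans hn); apply: (le_trans (leeD2r _ hL)).
apply: (le_trans (leeD2r _ (leeD2r _ hs))).
rewrite -!addeA; apply: leeD.
  apply: expectation_le => //.
  - exact: measurable_capped_inf.
  - exact: measurable_continuous_lfcount.
  - by move=> w; exact: capped_inf_ge0.
  - by move=> w; exact: F0.
  - apply: aeW => w; apply: le_trans (capped_inf_le _ _ _ _) _ => //.
    exact: cell_inf_le.
rewrite -!EFinD lee_fin; lra.
Qed.

Lemma cvg_in_law_cell_counts (R : realType) (d d' : measure_display)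
    (Om : measurableType d) (Om' : measurableType d')
    (P : probability Om R) (P' : probability Om' R)
    (N : R -> Om -> lfcount R) (N' : Om' -> lfcount R) :
  (\forall s \near +oo, point_process (N s)) -> point_process N' ->
  (forall n (k : {ffun 'I_(n * 2 ^ n) -> nat}),
    fine (P [set w | cell_counts n (N s w) = k]) @[s --> +oo] -->
    fine (P' [set w | cell_counts n (N' w) = k])) ->
  cvg_in_law P N P' N'.
Proof.
move=> ppN ppN' cvN F cF [M [Mr /(_ (`|M| + 1))]].
rewrite (le_lt_trans (ler_norm _)) ?ltrDl// => /(_ isT).
(* Boundedness only provides bounds strictly above M, whence the + 1. *)
set K := `|M| + 1 => FK.
have FKl mu : - K <= F mu <= K by rewrite -ler_norml; exact: FK.
have shift d0 (Om0 : measurableType d0) (P0 : probability Om0 R)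
    (N0 : Om0 -> lfcount R) : point_process N0 ->
    ('E_P0[F \o N0] \is a fin_num /\
     'E_P0[(fun mu => F mu + K)%R \o N0] = 'E_P0[F \o N0] + K%:E /\
     'E_P0[(fun mu => K - F mu)%R \o N0] = K%:E - 'E_P0[F \o N0])%E.
  move=> ppN0; rewrite unlock.
  have IF : P0.-integrable setT (EFin \o (F \o N0)).
    apply: measurable_bounded_integrable => //.
    - by rewrite (le_lt_trans (probability_le1 _ _)) ?ltry.
    - rewrite (_ : F \o N0 = (fun mu => F mu + K) \o N0 \- cst K); last first.
        by apply/funext => w /=; rewrite addrK.
      apply: measurable_funB => //; apply: measurable_continuous_lfcount => //.
        by move=> mu; have := FKl mu; lra.
      by move=> mu; exact: (cvgD (cF mu) (cvg_cst K)).
    - exists K; split; first exact: num_real.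
      by move=> x Kx w _; apply: le_trans (ltW Kx); rewrite /= ler_norml; exact: FKl.
  have IK : P0.-integrable setT (EFin \o cst K) by exact: finite_measure_integrable_cst.
  split; first exact: integrable_fin_num IF.
  have KE : (\int[P0]_x (EFin \o cst K) x = K%:E)%E.
    by have := expectation_cst P0 K; rewrite unlock.
  split.
    by rewrite -[in RHS]KE -integralD.
  by rewrite -[in RHS]KE -integralB.
have low : forall e, 0 < e -> \forall s \near +oo,
   ('E_P'[(fun mu => F mu + K)%R \o N'] <= 'E_P[(fun mu => F mu + K)%R \o N s] + e%:E)%E.
  move=> e e0; apply: (@liminf_expectation _ _ _ _ _ _ _ _ _ _ (K + K)) => //.
    by move=> mu; have := FKl mu; lra.
  by move=> mu; exact: (cvgD (cF mu) (cvg_cst K)).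
have upp : forall e, 0 < e -> \forall s \near +oo,
   ('E_P'[(fun mu => K - F mu)%R \o N'] <= 'E_P[(fun mu => K - F mu)%R \o N s] + e%:E)%E.
  move=> e e0; apply: (@liminf_expectation _ _ _ _ _ _ _ _ _ _ (K + K)) => //.
    by move=> mu; have := FKl mu; lra.
  by move=> mu; exact: (cvgB (cvg_cst K) (cF mu)).
have [fin' [eq1' eq2']] := shift _ _ P' N' ppN'.
rewrite -(fineK fin'); apply/fine_cvgP; split.
  by apply: filterS ppN => s /(shift _ _ P)[].
apply/cvgrPdist_le => e e0.
near=> s.
have ppNs : point_process (N s) by near: s.
have [fin [eq1 eq2]] := shift _ _ P (N s) ppNs.
have : ('E_P'[(fun mu => F mu + K)%R \o N'] <= 'E_P[(fun mu => F mu + K)%R \o N s] + e%:E)%E.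
  by near: s; exact: low.
have : ('E_P'[(fun mu => K - F mu)%R \o N'] <= 'E_P[(fun mu => K - F mu)%R \o N s] + e%:E)%E.
  by near: s; exact: upp.
rewrite eq1 eq2 eq1' eq2' -(fineK fin) -(fineK fin') -!EFinN -!EFinD !lee_fin /= => h1 h2.
by rewrite ler_norml; apply/andP; split; lra.
Unshelve. all: by end_near.
Qed.

(** * Poisson approximation of counts *)

Section sum_pmf.
Variables (R : realType) (m : nat).
Implicit Types (p : nat -> 'I_m -> R) (k : {ffun 'I_m -> int}).

Definition unit_ffun (l : 'I_m) : {ffun 'I_m -> int} := [ffun j => (j == l)%:R].

(* pmf of a sum of n independent random vectors, the i-th of which is the unit
   vector e_l with probability p i l, and 0 otherwise; the argument ranges over
   Z^m so that shifting it by e_l needs no side condition. *)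
Fixpoint sum_pmf p n k : R :=
  if n is n'.+1 then
    (1 - \sum_l p n' l) * sum_pmf p n' k +
    \sum_l p n' l * sum_pmf p n' (k - unit_ffun l)
  else (k == 0)%:R.

Variable p : nat -> 'I_m -> R.
Hypothesis p0 : forall i l, 0 <= p i l.
Hypothesis p1 : forall i, \sum_l p i l <= 1.

Let sp0 i : 0 <= \sum_l p i l.
Proof. exact: sumr_ge0. Qed.

Lemma sum_pmf_bounds n k : 0 <= sum_pmf p n k <= 1.
Proof.
elim: n k => [|n IH] k /=; first by case: eqP; rewrite lexx ler01.
have H0 k' : 0 <= sum_pmf p n k' by case/andP: (IH k').
have H1 k' : sum_pmf p n k' <= 1 by case/andP: (IH k').
apply/andP; split.
  rewrite addr_ge0 ?mulr_ge0// ?subr_ge0//.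
  by apply: sumr_ge0 => l _; rewrite mulr_ge0.
rewrite -[leRHS](subrK (\sum_l p n l)) lerD//.
  by rewrite ler_piMr// subr_ge0.
by apply: ler_sum => l _; rewrite ler_piMr.
Qed.

Lemma sum_pmf_lt0 n k l : (k l < 0)%R -> sum_pmf p n k = 0.
Proof.
elim: n k => [|n IH] k kl /=.
  by case: eqP => // k0; move: kl; rewrite k0 ffunE ltxx.
rewrite IH// mulr0 add0r big1// => j _; rewrite IH ?mulr0//.
by rewrite !ffunE; case: eqP => _ /=; move: kl; lra.
Qed.

Lemma sum_pmf0 n : sum_pmf p n 0 = \prod_(i < n) (1 - \sum_l p i l).
Proof.
elim: n => [|n IH]; first by rewrite big_ord0/= eqxx.
rewrite big_ord_recr/= IH mulrC [X in _ + X]big1 ?addr0// => l _.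
by rewrite (@sum_pmf_lt0 _ _ l) ?mulr0// !ffunE eqxx.
Qed.

Lemma sum_pmf_step n k : `|sum_pmf p n k - sum_pmf p n.+1 k| <= \sum_l p n l.
Proof.
rewrite /= (_ : sum_pmf p n k - _ =
    \sum_l p n l * (sum_pmf p n k - sum_pmf p n (k - unit_ffun l))); last first.
  under [RHS]eq_bigr do rewrite mulrBr; rewrite sumrB -mulr_suml; ring.
apply: le_trans (ler_norm_sum _ _ _) _; apply: ler_sum => l _.
rewrite normrM ger0_norm// ler_piMr// ler_norml.
by have := sum_pmf_bounds n k; have := sum_pmf_bounds n (k - unit_ffun l); lra.
Qed.

(* Approximate form of the recursion k_j pi(k) = Lambda_j pi(k - e_j) of the
   Poisson pmf. *)
Lemma sum_pmf_rec n k j :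
  `|(k j)%:~R * sum_pmf p n k -
    (\sum_(i < n) p i j) * sum_pmf p n (k - unit_ffun j)| <=
  \sum_(i < n) p i j * \sum_l p i l.
Proof.
elim: n k => [|n IH] k.
  rewrite !big_ord0 mul0r subr0 /=; case: eqP => [->|_]; last by rewrite mulr0 normr0.
  by rewrite ffunE mul0r normr0.
set D := fun k => (k j)%:~R * sum_pmf p n k -
    (\sum_(i < n) p i j) * sum_pmf p n (k - unit_ffun j).
(* The defect D is averaged with the same weights as the pmf, of total 1, so its bound B is
   preserved. The only new error is the last term, at most p n j times the total hitting probability
   by [sum_pmf_step]. *)
have DE : (k j)%:~R * sum_pmf p n.+1 k -
    (\sum_(i < n.+1) p i j) * sum_pmf p n.+1 (k - unit_ffun j) =
  (1 - \sum_l p n l) * D k + \sum_l p n l * D (k - unit_ffun l) +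
  p n j * (sum_pmf p n (k - unit_ffun j) - sum_pmf p n.+1 (k - unit_ffun j)).
  rewrite big_ord_recr /= /D.
  under [X in _ = _ + X + _]eq_bigr do rewrite mulrBr.
  rewrite sumrB.
  (* Subtracting e_l changes the j-th entry only when l = j, which produces the extra term. *)
  have -> : \sum_l p n l * (((k - unit_ffun l) j)%:~R * sum_pmf p n (k - unit_ffun l)) =
     (k j)%:~R * (\sum_l p n l * sum_pmf p n (k - unit_ffun l)) -
     p n j * sum_pmf p n (k - unit_ffun j).
    rewrite mulr_sumr (bigD1 j)//= [in RHS](bigD1 j)//= addrAC; congr (_ + _).
      by rewrite !ffunE eqxx/= intrB; ring.
    apply: eq_bigr => l lj; rewrite !ffunE eq_sym (negbTE lj) subr0; ring.
  have -> : \sum_l p n l * ((\sum_(i < n) p i j) *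
       sum_pmf p n (k - unit_ffun l - unit_ffun j)) =
     (\sum_(i < n) p i j) * \sum_l p n l * sum_pmf p n (k - unit_ffun j - unit_ffun l).
    by rewrite mulr_sumr; apply: eq_bigr => l _; rewrite (addrAC k); ring.
  ring.
rewrite DE big_ord_recr /=.
apply: le_trans (ler_normD _ _) _; apply: lerD; last first.
  by rewrite normrM ger0_norm// ler_wpM2l// sum_pmf_step.
apply: le_trans (ler_normD _ _) _.
set B := \sum_(i < n) p i j * \sum_l p i l in IH *.
rewrite [leRHS](_ : B = (1 - \sum_l p n l) * B + \sum_l p n l * B); last first.
  by rewrite -mulr_suml; ring.
apply: lerD.
  by rewrite normrM ger0_norm ?subr_ge0// ler_wpM2l ?subr_ge0//; exact: IH.
apply: le_trans (ler_norm_sum _ _ _) _; apply: ler_sum => l _.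
by rewrite normrM ger0_norm// ler_wpM2l//; exact: IH.
Qed.

Lemma sum_pmf0_expR n :
  `|sum_pmf p n 0 - expR (- \sum_(i < n) \sum_l p i l)| <=
  \sum_(i < n) (\sum_l p i l) ^+ 2.
Proof.
rewrite sum_pmf0; elim: n => [|n IH].
  by rewrite !big_ord0 oppr0 expR0 subrr normr0.
rewrite !big_ord_recr/=.
set a := \prod_(i < n) _ in IH *; set S := \sum_(i < n) _ in IH *.
set q := \sum_l p n l; rewrite opprD expRD.
have a01 : 0 <= a <= 1.
  by rewrite /a -sum_pmf0 sum_pmf_bounds.
have E01 : 0 <= expR (- q) <= 1.
  by rewrite expR_ge0 -expR0 ler_expR oppr_le0 sp0.
(* Telescoping: one factor 1 - q is exchanged for its exponential at a time. *)
rewrite (_ : _ - _ = (a - expR (- S)) * expR (- q) + a * (1 - q - expR (- q))); last ring.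
apply: le_trans (ler_normD _ _) _; apply: lerD.
  by rewrite normrM (ger0_norm (expR_ge0 _)); apply: le_trans IH; rewrite ler_piMr//; case/andP: E01.
rewrite normrM ger0_norm; last by case/andP: a01.
apply: (@le_trans _ _ `|1 - q - expR (- q)|); first by rewrite ler_piMl//; case/andP: a01.
have q01 : 0 <= q <= 1 by rewrite sp0 p1.
(* The lower bound is e^-q >= 1 - q; the upper one is e^-q <= 1 / (1 + q) <= 1 - q + q^2. *)
have h1 := @expR_ge1Dx R (- q); have h2 := @expR_ge1Dx R q.
have h3 : expR (- q) * expR q = 1 by rewrite -expRD addNr expR0.
have h4 := expR_gt0 (-q).
rewrite ler_norml; apply/andP; split; nra.
Qed.

End sum_pmf.

(** The recursion and the value at 0 determine the limit: induct on the total count, lowering some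
    positive k_j by one and dividing by it. *)
Lemma poisson_recursion_cvg (R : realType) (m : nat) (T : Type) (G : set_system T)
    {FG : Filter G}
    (q : T -> {ffun 'I_m -> int} -> R) (L : T -> 'I_m -> R) (l : 'I_m -> R) :
  (forall j, L s j @[s --> G] --> l j) ->
  (forall s (k : {ffun 'I_m -> int}) j, k j < 0 -> q s k = 0) ->
  (forall e, 0 < e -> \forall s \near G, forall (k : {ffun 'I_m -> int}) j,
    `|(k j)%:~R * q s k - L s j * q s (k - unit_ffun j)| <= e) ->
  (forall e, 0 < e -> \forall s \near G, `|q s 0 - expR (- \sum_j L s j)| <= e) ->
  forall k : {ffun 'I_m -> nat}, q s [ffun j => (k j)%:Z] @[s --> G] -->
    \prod_j (l j ^+ k j / (k j)`!%:R * expR (- l j)).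
Proof.
move=> Ll q0 qrec qbase k.
have [n] := ubnP (\sum_j k j)%N; elim: n k => // n IH k kn.
have [k0|/existsNP[j /eqP kj]] := pselect (forall j, k j = 0%N).
  rewrite (_ : [ffun j => (k j)%:Z] = 0); last by apply/ffunP => j; rewrite !ffunE k0.
  rewrite (_ : \prod_j _ = expR (- \sum_j l j)); last first.
    rewrite -sumrN expR_sum; apply: eq_bigr => j _.
    by rewrite k0 expr0 fact0 divr1 mul1r.
  apply/cvgrPdist_le => e e0.
  have cE : expR (- \sum_j L s j) @[s --> G] --> expR (- \sum_j l j).
    apply: continuous_cvg; first exact: continuous_expR.
    by apply: cvgN; apply: cvg_big => //; exact: add_continuous.
  have e20 : 0 < e / 2 by rewrite divr_gt0.
  move/cvgrPdist_le : cE => /(_ _ e20) cE.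
  have {}qbase := qbase _ e20.
  near=> s.
  have h1 : `|q s 0 - expR (- \sum_j L s j)| <= e / 2 by near: s.
  have h2 : `|expR (- \sum_j l j) - expR (- \sum_j L s j)| <= e / 2 by near: s.
  move: h1 h2; rewrite !ler_norml => /andP[? ?] /andP[? ?].
  by apply/andP; split; lra.
pose k' : {ffun 'I_m -> nat} := [ffun i => (k i - (i == j))%N].
have kj0 : (0 < k j)%N by rewrite lt0n.
(* The truncated subtraction of naturals agrees with the integer shift because k j > 0. *)
have k'E : [ffun i => (k i)%:Z] - unit_ffun j = [ffun i => (k' i)%:Z] :> {ffun 'I_m -> int}.
  apply/ffunP => i; rewrite !ffunE; case: eqP => [->|_]; last by rewrite subr0 subn0.
  by rewrite -subzn.
have /IH : (\sum_i k' i < n)%N.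
  move: kn; rewrite (bigD1 j)//= [in X in _ -> X](bigD1 j)//= ltnS; apply: leq_trans.
  rewrite ffunE eqxx -[X in (_ < X + _)%N](ltn_predK kj0) addSn ltnS subn1 leq_add2l.
  by apply: leq_sum => i _; rewrite ffunE leq_subr.
set pi' := \prod_i _ => IHk'.
have -> : \prod_i (l i ^+ k i / (k i)`!%:R * expR (- l i)) = (k j)%:R^-1 * (l j * pi').
  rewrite /pi' (bigD1 j)//= [in RHS](bigD1 j)//=; rewrite !mulrA; congr (_ * _).
    rewrite ffunE eqxx subn1 -{1 2}(ltn_predK kj0) factS exprS natrM invfM.
    by rewrite (ltn_predK kj0); ring.
  by apply: eq_bigr => i /negbTE ij; rewrite ffunE ij subn0.
have kjR : 0 < (k j)%:R :> R by rewrite ltr0n.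
apply: (@cvg_trans _ ((k j)%:R^-1 * ((k j)%:R * q s [ffun i => (k i)%:Z]) @[s --> G])).
  by apply: near_eq_cvg; apply: nearW => s; rewrite mulrA mulVf ?mul1r// gt_eqF.
apply: cvgMl_tmp; apply/cvgrPdist_le => e e0.
have e20 : 0 < e / 2 by rewrite divr_gt0.
have /cvgrPdist_le/(_ _ e20) cP : L s j * q s [ffun j => (k' j)%:Z] @[s --> G] --> l j * pi'.
  exact: cvgM (Ll j) IHk'.
have {}qrec := qrec _ e20.
near=> s.
have h2 : `|l j * pi' - L s j * q s [ffun i => (k' i)%:Z]| <= e / 2 by near: s.
have : forall (k : {ffun 'I_m -> int}) j, `|(k j)%:~R * q s k - L s j * q s (k - unit_ffun j)| <= e / 2 by near: s.
move=> /(_ [ffun i => (k i)%:Z] j); rewrite k'E ffunE -pmulrn.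
move: h2; rewrite !ler_norml => /andP[? ?] /andP[? ?].
by apply/andP; split; lra.
Unshelve. all: by end_near.
Qed.

(** * Exact law of the counts of independent variables *)

Section independent_counts.
Variables (d : measure_display) (Omega : measurableType d) (R : realType).
Variables (P : probability Omega R) (Z : nat -> {RV P >-> R}).
Hypothesis indepZ : mutually_independent Z.
Variables (m : nat) (C : nat -> 'I_m -> set R).
Hypothesis mC : forall i j, measurable (C i j).
Hypothesis tC : forall i, trivIset setT (C i).

Let p i j := fine (P (Z i @^-1` C i j)).

Definition partial_counts n (k : {ffun 'I_m -> int}) : set Omega :=
  [set w | forall j, \sum_(i < n) \1_(C i j) (Z i w) = (k j)%:~R :> R].

Lemma measurable_RV_preimage i (B : set R) : measurable B -> measurable (Z i @^-1` B).
Proof. by move=> mB; rewrite -[X in measurable X]setTI; exact: (measurable_funPT (Z i)). Qed.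

Let mU i : measurable (\big[setU/set0]_(j < m) C i j).
Proof. exact: bigsetU_measurable. Qed.

Let UP i x : (\big[setU/set0]_(j < m) C i j) x <-> exists j, C i j x.
Proof.
rewrite -bigcup_seq; split => [[j _ h]|[j h]]; first by exists j.
by exists j => //=; rewrite mem_index_enum.
Qed.

Let cell_inj n l j x : C n l x -> C n j x -> l = j.
Proof. by move=> Cl Cj; have t : trivIset setT (C n) := @tC n; apply: t => //; exists x. Qed.

Lemma cell_prob_fin i j : P (Z i @^-1` C i j) = (p i j)%:E.
Proof. by rewrite fineK// fin_num_measure//; exact: measurable_RV_preimage. Qed.

Lemma cell_prob_ge0 i j : 0 <= p i j.
Proof. exact: fine_ge0. Qed.

Lemma cell_prob_sum i :
  P (Z i @^-1` \big[setU/set0]_(j < m) C i j) = (\sum_j p i j)%:E.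
Proof.
rewrite -bigcup_seq preimage_bigcup bigcup_seq measure_semi_additive_ord//.
- by rewrite -sumEFin; apply: eq_bigr => j _; exact: cell_prob_fin.
- by move=> j; exact: measurable_RV_preimage.
- by move=> a b _ _ [w [Ca Cb]]; exact: cell_inj Ca Cb.
- by apply: bigsetU_measurable => j _; exact: measurable_RV_preimage.
Qed.

Lemma cell_prob_le1 i : \sum_j p i j <= 1.
Proof.
rewrite -lee_fin -cell_prob_sum probability_le1//; exact: measurable_RV_preimage.
Qed.

Lemma measurable_partial_counts n k : measurable (partial_counts n k).
Proof.
rewrite (_ : partial_counts n k = \bigcap_(j in [set: 'I_m])
    ((fun w => \sum_(i < n) \1_(C i j) (Z i w)) @^-1` [set (k j)%:~R : R])); last first.
  by apply/seteqP; split => w /= h j; [move=> _|]; exact: h.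
apply: fin_bigcap_measurable => [|j _]; first exact: finite_finset.
rewrite -[X in measurable X]setTI.
apply: measurable_sum => // i; apply: measurableT_comp => //; exact: measurable_indic.
Qed.

Definition late_event n M (B : nat -> set R) : set Omega :=
  \bigcap_(i in [set i | (n <= i < M)%N]) (Z i @^-1` B i).

Lemma measurable_late_event n M B : (forall i, measurable (B i)) ->
  measurable (late_event n M B).
Proof.
move=> mB; apply: fin_bigcap_measurable; last first.
  by move=> i _; exact: measurable_RV_preimage.
by apply: (sub_finite_set _ (finite_II M)) => i /= /andP[].
Qed.

Lemma late_event_prob M B : (forall i, measurable (B i)) ->
  P (late_event 0 M B) = (\prod_(0 <= i < M) P (Z i @^-1` B i))%E.
Proof.
move=> mB; have := indepZ [fset i | i in iota 0 M]%fset mB.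
rewrite (_ : \bigcap_(_ in _) _ = late_event 0 M B); last first.
  congr (\bigcap_(i in _) _); apply/seteqP; split => i /=.
    by move=> /imfsetP[j /=]; rewrite mem_iota => /andP[_ jM] ->.
  by move=> iM; apply/imfsetP; exists i; rewrite //= mem_iota.
move=> ->; rewrite /index_iota subn0; apply: perm_big.
apply: uniq_perm; [exact: fset_uniq|exact: iota_uniq|].
by move=> i; apply/imfsetP/idP => [[j /= ? ->]//|?]; exists i.
Qed.

Let setB (B : nat -> set R) n S i := if i == n then S else B i.

Let msetB B n S : (forall i, measurable (B i)) -> measurable S ->
  forall i, measurable (setB B n S i).
Proof. by move=> mB mS i; rewrite /setB; case: ifP. Qed.

Let late_event_setB B n M S : (n < M)%N ->
  late_event n M (setB B n S) = late_event n.+1 M B `&` Z n @^-1` S.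
Proof.
move=> nM; apply/seteqP; split => w /=.
  move=> h; split; last by have := h n; rewrite /setB/= eqxx leqnn => /(_ nM).
  move=> i /= /andP[ni iM]; have := h i; rewrite /setB/= iM ltnW//= => /(_ isT).
  by rewrite gtn_eqF.
move=> [h hn] i /= /andP[ni iM]; rewrite /setB; case: eqP => [->//|/eqP in_].
by apply: h; rewrite /= iM andbT ltn_neqAle eq_sym in_.
Qed.

Let prod_setB B n M S : (n < M)%N ->
  (\prod_(n <= i < M) P (Z i @^-1` setB B n S i) =
   P (Z n @^-1` S) * \prod_(n.+1 <= i < M) P (Z i @^-1` B i))%E.
Proof.
move=> nM; rewrite big_ltn// /setB eqxx; congr (_ * _)%E.
by apply: eq_big_nat => i /andP[ni _]; rewrite gtn_eqF.
Qed.

(* Keeping track of the later coordinates makes the induction on n possible: each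
   step absorbs the event about the n-th one into the late event. *)
Lemma partial_counts_late n M k B : (n <= M)%N -> (forall i, measurable (B i)) ->
  P (partial_counts n k `&` late_event n M B) =
  ((sum_pmf p n k)%:E * \prod_(n <= i < M) P (Z i @^-1` B i))%E.
Proof.
elim: n k B => [|n IH] k B nM mB.
  rewrite -late_event_prob//=; have [->|/eqP k0] := eqVneq k 0.
    rewrite mul1e; congr (P _); apply/seteqP; split => [w []//|w h]; split => // j.
    by rewrite big_ord0 ffunE.
  rewrite mul0e (_ : _ `&` _ = set0) ?measure0//; apply/seteqP; split => // w [/= h _].
  apply: k0; apply/ffunP => j; have := h j; rewrite big_ord0 ffunE => /esym/eqP.
  by rewrite intr_eq0 => /eqP.
set A := _ `&` _; pose U := \big[setU/set0]_(j < m) C n j.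
have mA : measurable A.
  by apply: measurableI; [exact: measurable_partial_counts|exact: measurable_late_event].
have mV : measurable (Z n @^-1` U) by apply: measurable_RV_preimage; exact: mU.
(* Split on whether Z n falls in one of its cells. If not, the first n variables already have counts
   k; if it falls in cell j, they have counts k - e_j. Either way the condition on Z n becomes the
   n-th slot of a late event. *)
rewrite (measureDI P mA mV).
have -> : A `\` Z n @^-1` U = partial_counts n k `&` late_event n M (setB B n (~` U)).
  rewrite late_event_setB// setDE -preimage_setC setIA; apply/seteqP; split => w.
    move=> [[h hl] /= hU]; split => //; split => // j.
    have := h j; rewrite big_ord_recr/= indicE memNset ?addr0// => Cj.
    by apply: hU; apply/UP; exists j.
  move=> [[h hl] /= hU]; split => //; split => // j.
  rewrite big_ord_recr/= indicE memNset ?addr0// => Cj.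
  by apply: hU; apply/UP; exists j.
have -> : A `&` Z n @^-1` U = \big[setU/set0]_(j < m)
   (partial_counts n (k - unit_ffun j) `&` late_event n M (setB B n (C n j))).
  have cntE w j l : C n j w ->
    (\1_(C n l) w = (l == j)%:R :> R).
    move=> Cj; rewrite indicE; congr (nat_of_bool _)%:R; apply/idP/eqP; rewrite inE.
      by move=> Cl; exact: cell_inj Cl Cj.
    by move=> ->.
  have subE j l : ((k - unit_ffun j) l)%:~R = (k l)%:~R - (l == j)%:R :> R.
    by rewrite !ffunE intrB; case: eqP.
  rewrite -bigcup_seq; apply/seteqP; split => w /=.
    move=> [[h hl] /UP[j Cj]]; exists j; first by rewrite /= mem_index_enum.
    rewrite late_event_setB//; split => // l.
    by have := h l; rewrite big_ord_recr/= (cntE _ _ _ Cj) subE => <-; rewrite addrK.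
  move=> [j _]; rewrite late_event_setB// => -[h [hl Cj]]; split; last by apply/UP; exists j.
  by split => // l; rewrite big_ord_recr/= (cntE _ _ _ Cj) h subE subrK.
rewrite measure_semi_additive_ord; last 3 first.
- move=> j; apply: measurableI; first exact: measurable_partial_counts.
  by apply: measurable_late_event; exact: msetB.
- apply/trivIsetP => i j _ _ ij; apply/seteqP; split => // w [[_]].
  rewrite !late_event_setB// => -[_ Ci] [_ [_ Cj]].
  by case/eqP: ij; exact: cell_inj Ci Cj.
- apply: bigsetU_measurable => j _; apply: measurableI; first exact: measurable_partial_counts.
  by apply: measurable_late_event; exact: msetB.
pose F := fine (\prod_(n.+1 <= i < M) P (Z i @^-1` B i))%E.
have Ffin : (\prod_(n.+1 <= i < M) P (Z i @^-1` B i))%E \is a fin_num.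
  apply: prode_fin_num => i _; rewrite fin_num_measure//; exact: measurable_RV_preimage.
rewrite -(fineK Ffin) -/F.
apply: (@eq_trans _ _ ((sum_pmf p n k)%:E * ((1 - \sum_j p n j)%:E * F%:E) +
    \sum_(j < m) (sum_pmf p n (k - unit_ffun j))%:E * ((p n j)%:E * F%:E))%E).
  congr (_ + _)%E.
    have mBU : forall i, measurable (setB B n (~` U) i).
      by apply: msetB => //; apply: measurableC; exact: mU.
    apply: (eq_trans (IH k _ (ltnW nM) mBU)); rewrite prod_setB// -(fineK Ffin) -/F.
    have -> : P (Z n @^-1` (~` U)) = (1 - \sum_j p n j)%:E; last by [].
    by rewrite preimage_setC (probability_setC P mV) EFinB -cell_prob_sum.
  apply: eq_bigr => j _.
  have mBC : forall i, measurable (setB B n (C n j) i) by exact: msetB.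
  apply: (eq_trans (IH _ _ (ltnW nM) mBC)); rewrite prod_setB// -(fineK Ffin) -/F.
  have -> : P (Z n @^-1` C n j) = (p n j)%:E by exact: cell_prob_fin.
  by [].
have -> : (\sum_(j < m) (sum_pmf p n (k - unit_ffun j))%:E * ((p n j)%:E * F%:E) =
    (\sum_j sum_pmf p n (k - unit_ffun j) * (p n j * F))%:E)%E.
  by rewrite -sumEFin; apply: eq_bigr => j _.
rewrite -!EFinM -EFinD; congr (_%:E).
have -> : sum_pmf p n.+1 k = (1 - \sum_l p n l) * sum_pmf p n k +
    \sum_l p n l * sum_pmf p n (k - unit_ffun l) by [].
rewrite [RHS]mulrDl [X in _ = _ + X]mulr_suml; congr (_ + _); first ring.
by apply: eq_bigr => j _; ring.
Qed.

Lemma partial_counts_prob n k : P (partial_counts n k) = (sum_pmf p n k)%:E.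
Proof.
have := @partial_counts_late n n k (fun=> setT) (leqnn n) (fun=> measurableT).
rewrite big_geq// mule1 => <-; congr (P _); apply/seteqP; split => [w h|w []//].
split => // i /= /andP[ni /(leq_trans _) h1]; have := h1 _ ni; by rewrite ltnn.
Qed.


Definition total_counts (k : {ffun 'I_m -> int}) : set Omega :=
  [set w | forall j, (\sum_(0 <= i <oo) (\1_(C i j) (Z i w))%:E = ((k j)%:~R : R)%:E)%E].

Lemma measurable_total_counts k : measurable (total_counts k).
Proof.
rewrite (_ : total_counts k = \bigcap_(j in [set: 'I_m])
    ((fun w => \sum_(0 <= i <oo) (\1_(C i j) (Z i w))%:E)%E @^-1`
     [set ((k j)%:~R : R)%:E])); last first.
  by apply/seteqP; split => w /= h j; [move=> _|]; exact: h.
apply: fin_bigcap_measurable => [|j _]; first exact: finite_finset.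
rewrite -[X in measurable X]setTI.
apply: ge0_emeasurable_sum => //.
by move=> i _; apply/measurable_EFinP; apply: measurableT_comp.
Qed.

Lemma total_counts_lt0 (k : {ffun 'I_m -> int}) j : k j < 0 -> total_counts k = set0.
Proof.
move=> kj; apply/seteqP; split => // w /= /(_ j) h.
have : (0 <= \sum_(0 <= i <oo) (\1_(C i j) (Z i w) : R)%:E)%E.
  by apply: nneseries_ge0 => i _ _; rewrite lee_fin.
by rewrite h lee_fin ler0z leNgt kj.
Qed.

Variable L : 'I_m -> R.
Hypothesis PL : forall j, (\sum_(0 <= i <oo) P (Z i @^-1` C i j) = (L j)%:E)%E.

Let U i := \big[setU/set0]_(j < m) C i j.
Let late n := \bigcup_(i in ~` `I_n) (Z i @^-1` U i).

Let mlate n : measurable (late n).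
Proof.
apply: bigcup_measurable => i _; apply: measurable_RV_preimage; exact: mU.
Qed.

Lemma partial_total_counts n k w : ~ late n w ->
  partial_counts n k w <-> total_counts k w.
Proof.
move=> nl; rewrite /partial_counts /total_counts/=.
have E j : (\sum_(0 <= i <oo) (\1_(C i j) (Z i w) : R)%:E =
   (\sum_(i < n) \1_(C i j) (Z i w))%:E)%E.
  rewrite (nneseries_split _ n)//.
  rewrite eseries0 ?adde0; first by rewrite add0n big_mkord sumEFin.
  move=> i; rewrite add0n => ni _; rewrite indicE memNset// => Cj.
  apply: nl; exists i; first by move=> /=; apply/negP; rewrite -leqNgt.
  by apply/UP; exists j.
by split => h j; [rewrite E h|have := h j; rewrite E => -[]].
Qed.

Let tail n : \bar R := (\sum_(n <= i <oo) (\sum_j p i j)%:E)%E.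

Lemma summable_cell_prob : (\sum_(0 <= i <oo) (\sum_j p i j)%:E = (\sum_j L j)%:E)%E.
Proof.
under eq_eseriesr do rewrite -sumEFin.
rewrite nneseries_sum; last by move=> *; rewrite lee_fin cell_prob_ge0.
rewrite -sumEFin; apply: eq_bigr => j _; rewrite -PL.
by apply: eq_eseriesr => i _; rewrite cell_prob_fin.
Qed.

Lemma late_prob n : (P (late n) <= tail n)%E.
Proof.
apply: (@le_trans _ _ (\sum_(n <= i <oo) P (Z i @^-1` U i))%E).
  apply: measure_sigma_subadditive_tail => //.
  by move=> i; apply: measurable_RV_preimage; exact: mU.
apply: lee_nneseries => // i _; by rewrite cell_prob_sum.
Qed.

(** The finite and infinite count events agree off [late n], whose probability is at most a tail of
    the convergent series of hitting probabilities. *)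
Lemma cvg_total_counts k :
  sum_pmf p n k @[n --> \oo] --> fine (P (total_counts k)).
Proof.
apply/cvgrPdist_le => e e0.
have tail0 : tail n @[n --> \oo] --> 0%E.
  apply: nneseries_tail_cvg; first by rewrite summable_cell_prob ltry.
  by move=> i _; rewrite lee_fin sumr_ge0// => j _; exact: cell_prob_ge0.
have : \forall n \near \oo, (tail n <= e%:E)%E.
  by move/fine_cvgP : tail0 => [fin /cvgrPdist_le/(_ _ e0)]; apply: filterS2 fin => n fin;
    rewrite sub0r normrN => h; rewrite -(fineK fin) lee_fin (le_trans (ler_norm _)).
apply: filterS => n tn.
have mE := measurable_total_counts k; have mp := measurable_partial_counts n k.
have Efin : P (total_counts k) \is a fin_num by exact: fin_num_measure.
have h1 : (P (total_counts k) <= P (partial_counts n k) + e%:E)%E.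
  apply: (@le_trans _ _ (P (partial_counts n k `|` late n))).
    apply: le_measure; rewrite ?inE//; first exact: measurableU.
    move=> w tw; have [|nl] := pselect (late n w); [by right|left].
    exact/(partial_total_counts _ nl).
  by rewrite (le_trans (measureU2 _ _ _))// leeD2l// (le_trans (late_prob n)).
have h2 : (P (partial_counts n k) <= P (total_counts k) + e%:E)%E.
  apply: (@le_trans _ _ (P (total_counts k `|` late n))).
    apply: le_measure; rewrite ?inE//; first exact: measurableU.
    move=> w tw; have [|nl] := pselect (late n w); [by right|left].
    exact/(partial_total_counts _ nl).
  by rewrite (le_trans (measureU2 _ _ _))// leeD2l// (le_trans (late_prob n)).
move: h1 h2; rewrite partial_counts_prob -(fineK Efin) -!EFinD !lee_fin => h1 h2.
by rewrite ler_norml; apply/andP; split; lra.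
Qed.

Let cvgL j : \sum_(i < n) p i j @[n --> \oo] --> L j.
Proof.
have := PL j.
under eq_eseriesr do rewrite cell_prob_fin.
move=> h; have : (\sum_(0 <= i < n) (p i j)%:E)%E @[n --> \oo] --> (L j)%:E.
  by rewrite -h; apply: is_cvg_nneseries => i _ _; rewrite lee_fin cell_prob_ge0.
move/fine_cvgP => [_]; apply: cvg_trans; apply: near_eq_cvg; apply: nearW => n /=.
by rewrite sumEFin/= big_mkord.
Qed.

Let partial_sum_le n : \sum_(i < n) \sum_j p i j <= \sum_j L j.
Proof.
rewrite exchange_big/=; apply: ler_sum => j _.
rewrite -lee_fin -PL -sumEFin -(big_mkord xpredT (fun i => (p i j)%:E)).
under eq_eseriesr do rewrite cell_prob_fin.
by apply: nneseries_lim_ge => i _ _; rewrite lee_fin cell_prob_ge0.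
Qed.

Variable e : R.
Hypothesis pe : forall i, \sum_j p i j <= e.

Let psum_ge0 i : 0 <= \sum_j p i j.
Proof. by apply: sumr_ge0 => j _; exact: cell_prob_ge0. Qed.

(** Limit of [sum_pmf_rec]: its error is quadratic in the hitting probabilities, hence at most their
    row bound e times the expected total number of hits. *)
Lemma total_counts_rec (k : {ffun 'I_m -> int}) j :
  `|(k j)%:~R * fine (P (total_counts k)) -
    L j * fine (P (total_counts (k - unit_ffun j)))| <= e * \sum_j L j.
Proof.
have h : `|(k j)%:~R * sum_pmf p n k -
    (\sum_(i < n) p i j) * sum_pmf p n (k - unit_ffun j)| @[n --> \oo] -->
  `|(k j)%:~R * fine (P (total_counts k)) -
    L j * fine (P (total_counts (k - unit_ffun j)))|.
  apply: cvg_norm; apply: cvgB.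
    by apply: cvgMl_tmp; exact: cvg_total_counts.
  by apply: cvgM; [exact: cvgL|exact: cvg_total_counts].
apply: (ler_cvg_to h (cvg_cst _)); apply: nearW => n.
apply: le_trans (sum_pmf_rec cell_prob_ge0 cell_prob_le1 _ _ _) _.
apply: (@le_trans _ _ (e * \sum_(i < n) \sum_j p i j)).
  rewrite mulr_sumr; apply: ler_sum => i _.
  rewrite mulrC ler_pM ?cell_prob_ge0//.
  by rewrite (bigD1 j)//= lerDl sumr_ge0// => l _; exact: cell_prob_ge0.
by rewrite ler_wpM2l// (le_trans (psum_ge0 0) (pe 0)).
Qed.

Lemma total_counts0 :
  `|fine (P (total_counts 0)) - expR (- \sum_j L j)| <= e * \sum_j L j.
Proof.
have h : `|sum_pmf p n 0 - expR (- \sum_(i < n) \sum_l p i l)| @[n --> \oo] -->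
  `|fine (P (total_counts 0)) - expR (- \sum_j L j)|.
  apply: cvg_norm; apply: cvgB; first exact: cvg_total_counts.
  apply: continuous_cvg; first exact: continuous_expR.
  apply: cvgN; under eq_fun do rewrite exchange_big/=.
  by apply: cvg_big => [|j _]; [exact: add_continuous|exact: cvgL].
apply: (ler_cvg_to h (cvg_cst _)); apply: nearW => n.
apply: le_trans (sum_pmf0_expR cell_prob_ge0 cell_prob_le1 _) _.
apply: (@le_trans _ _ (e * \sum_(i < n) \sum_j p i j)).
  by rewrite mulr_sumr; apply: ler_sum => i _; rewrite expr2 ler_wpM2r.
by rewrite ler_wpM2l// (le_trans (psum_ge0 0) (pe 0)).
Qed.

End independent_counts.

Lemma null_array_cvg (d : measure_display) (Omega : measurableType d) (R : realType)
    (P : probability Omega R) (Z : nat -> {RV P >-> R}) (m : nat)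
    (T : Type) (G : set_system T) {FG : Filter G} (C : T -> nat -> 'I_m -> set R)
    (l : 'I_m -> R) :
  mutually_independent Z ->
  (forall s i j, measurable (C s i j)) -> (forall s i, trivIset setT (C s i)) ->
  (forall j, (\sum_(0 <= i <oo) P (Z i @^-1` C s i j))%E @[s --> G] --> (l j)%:E) ->
  (forall e, 0 < e -> \forall s \near G, forall i j, (P (Z i @^-1` C s i j) <= e%:E)%E) ->
  forall k : {ffun 'I_m -> nat},
  fine (P [set w | forall j,
    (\sum_(0 <= i <oo) (\1_(C s i j) (Z i w))%:E = ((k j)%:R : R)%:E)%E]) @[s --> G] -->
  \prod_j (l j ^+ k j / (k j)`!%:R * expR (- l j)).
Proof.
move=> iZ mC tC Ll small k.
pose L s j := fine (\sum_(0 <= i <oo) P (Z i @^-1` C s i j))%E.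
have LL j : L s j @[s --> G] --> l j by case/fine_cvgP : (Ll j).
have Lfin : \forall s \near G, forall j, (\sum_(0 <= i <oo) P (Z i @^-1` C s i j) = (L s j)%:E)%E.
  apply: filter_forall => j; case/fine_cvgP : (Ll j) => + _.
  by apply: filterS => s fin; rewrite /L fineK.
pose B := `|\sum_j l j| + 1.
have B0 : 0 < B by rewrite ltr_wpDl.
have LB : \forall s \near G, \sum_j L s j <= B.
  have : \sum_j L s j @[s --> G] --> \sum_j l j.
    by apply: cvg_big => //; exact: add_continuous.
  move/cvgrPdist_le/(_ _ ltr01); apply: filterS => s.
  rewrite ler_norml /B => /andP[+ _]; have := ler_norm (\sum_j l j); lra.
have key e : 0 < e -> \forall s \near G, exists2 e', e' * \sum_j L s j <= e &
    (forall i, \sum_j fine (P (Z i @^-1` C s i j)) <= e').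
  (* At most e / B / (m + 1) for each of the m cells gives a row sum at most e / B, and the total
     mean is at most B. The + 1 allows m = 0. *)
  move=> e0; have e'0 : 0 < e / B / m.+1%:R by rewrite !divr_gt0.
  apply: filterS2 LB (small _ e'0) => s LsB h; exists (e / B).
    by rewrite -[leRHS](divfK (lt0r_neq0 B0)) ler_wpM2l// ltW// divr_gt0.
  move=> i; apply: (@le_trans _ _ (\sum_(j < m) e / B / m.+1%:R)).
    apply: ler_sum => j _; rewrite -lee_fin fineK// fin_num_measure//.
    exact: measurable_RV_preimage.
  have m0 : m.+1%:R != 0 :> R by rewrite pnatr_eq0.
  rewrite sumr_const card_ord -[leRHS](divfK m0) -[leLHS]mulr_natr.
  by rewrite ler_wpM2l ?ler_nat// ltW.
have := @poisson_recursion_cvg R m T G FG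
  (fun s k => fine (P (total_counts Z (C s) k))) L l LL _ _ _ k.
move=> H; rewrite (_ : (fun s => fine (P [set w | _])) =
    fun s => fine (P (total_counts Z (C s) [ffun j => (k j)%:Z]))); last first.
  apply/funext => s; congr (fine (P _)); apply/seteqP.
  by split => w /= h j; have := h j; rewrite ffunE.
apply: H.
- by move=> s k' j kj; rewrite (total_counts_lt0 _ _ kj) measure0.
- move=> e e0; apply: filterS2 Lfin (key e e0) => s Ls [e' he pe] k' j.
  exact: le_trans (total_counts_rec iZ (mC s) (tC s) Ls pe _ _) he.
- move=> e e0; apply: filterS2 Lfin (key e e0) => s Ls [e' he pe].
  exact: le_trans (total_counts0 iZ (mC s) (tC s) Ls pe) he.
Qed.

(** * Tilting of the normal law *)

Section normal_tilt.
Variable R : realType.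
Local Notation mu := (@lebesgue_measure R).
Implicit Types (m s t x : R) (f : R -> \bar R).

Lemma integral_normal_prob m f :
  measurable_fun setT f -> (forall x, 0 <= f x)%E ->
  (\int[normal_prob m 1]_x f x = \int[mu]_x (f x * (normal_pdf m 1 x)%:E))%E.
Proof.
move=> mf f0; have dom := normal_prob_dominates m (1 : R).
have mpdf : measurable_fun setT (fun x => (normal_pdf m 1 x)%:E).
  by apply/measurable_EFinP; exact: measurable_normal_pdf.
have iRN := Radon_Nikodym_SigmaFinite.f_integrable dom.
have mRN := measurable_int _ iRN.
rewrite -(Radon_Nikodym_SigmaFinite.change_of_variables dom f0 measurableT mf).
apply: ae_eq_integral => //.
- exact: emeasurable_funM.
- exact: emeasurable_funM.
(* The Radon-Nikodym derivative and the explicit density have the same integral over every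
   measurable set. *)
- apply: ae_eqe_mul2l; apply: integral_ae_eq => // E _ mE.
  by rewrite -(Radon_Nikodym_SigmaFinite.f_integral dom mE).
Qed.

Lemma normal_pdf_tilt m s x :
  expR (s * (x - m) - s ^+ 2 / 2) * normal_pdf m 1 x = normal_pdf (m + s) 1 x.
Proof.
rewrite !normal_pdfE ?oner_eq0// /normal_fun mulrCA -expRD; congr (_ * expR _).
by field.
Qed.

(** The Cameron-Martin shift in dimension one; the identity of densities is completion of the
    square. *)
Lemma integral_normal_tilt m s f :
  measurable_fun setT f -> (forall x, 0 <= f x)%E ->
  (\int[normal_prob m 1]_x ((expR (s * (x - m) - s ^+ 2 / 2))%:E * f x) =
   \int[normal_prob (m + s) 1]_x f x)%E.
Proof.
move=> mf f0.
have mE : measurable_fun setT (fun x => (expR (s * (x - m) - s ^+ 2 / 2))%:E * f x)%E.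
  apply: emeasurable_funM => //; apply/measurable_EFinP; apply: measurableT_comp => //.
  by apply: measurable_funB => //; apply: measurable_funM => //; apply: measurable_funB.
have E0 x : (0 <= (expR (s * (x - m) - s ^+ 2 / 2))%:E * f x)%E.
  by rewrite mule_ge0// lee_fin expR_ge0.
rewrite (integral_normal_prob m mE E0) (integral_normal_prob (m + s) mf f0).
by apply: eq_integral => x _; rewrite muleAC -EFinM normal_pdf_tilt muleC.
Qed.

Lemma integral_normal_cst m (c : R) : (\int[normal_prob m 1]_x c%:E = c%:E)%E.
Proof.
rewrite integral_cst// [X in (_ * X)%E](_ : _ = 1%E) ?mule1//.
exact: probability_setT.
Qed.

(** Chernoff bound with parameter 1: the indicator is at most exp (s (x - m) - t), whose integral is
    computed by tilting. The sign s = 1 or -1 selects the side; an exponential rate suffices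
    below. *)
Lemma normal_prob_tail m s t : s ^+ 2 = 1 ->
  (normal_prob m 1 [set x | (t < s * (x - m))%R] <= (expR (1 / 2 - t))%:E)%E.
Proof.
move=> s1.
have mf : measurable_fun setT (fun x => s * (x - m)).
  by apply: measurable_funM => //; apply: measurable_funB.
have mA : measurable [set x | t < s * (x - m)].
  rewrite (_ : [set x | _] = (fun x => s * (x - m)) @^-1` `]t, +oo[%classic); last first.
    by apply/seteqP; split => x /=; rewrite in_itv/= andbT.
  by rewrite -[X in measurable X]setTI; apply: mf.
have mE : measurable_fun setT (fun x => (expR (1 / 2 - t))%:E).
  exact: measurable_cst.
rewrite -[X in normal_prob m 1 X]setIT -(integral_indic _ measurableT)//.
apply: (@le_trans _ _ (\int[normal_prob m 1]_x
    ((expR (s * (x - m) - s ^+ 2 / 2))%:E * (expR (1 / 2 - t))%:E))%E).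
  apply: ge0_le_integral => //.
  - by apply/measurable_EFinP; exact: measurable_indic.
  - apply: emeasurable_funM => //; apply/measurable_EFinP; apply: measurableT_comp => //.
    exact: measurable_funB.
  - move=> x _; rewrite -EFinM -expRD lee_fin indicE s1.
    have [|] := boolP (x \in _); last by rewrite expR_ge0.
    rewrite inE/= => tx; rewrite -[leLHS]expR0 ler_expR; lra.
by rewrite integral_normal_tilt// integral_normal_cst.
Qed.

Lemma near_expR_le (c b e : R) : 0 < c -> 0 < e ->
  \forall s \near +oo, expR (b - c * s) <= e.
Proof.
move=> c0 e0; apply: filterS (nbhs_pinfty_ge (num_real ((b - ln e) / c))) => s.
by rewrite ler_pdivrMr// => h; rewrite -[leRHS]lnK ?posrE// ler_expR; lra.
Qed.

Lemma normal_prob_dist_gt m t :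
  (normal_prob m 1 [set x | (t < `|x - m|)%R] <= (expR (1 / 2 - t) *+ 2)%:E)%E.
Proof.
have mf s : measurable [set x | (t < s * (x - m))%R].
  rewrite (_ : [set x | _] = (fun x => s * (x - m)) @^-1` `]t, +oo[%classic); last first.
    by apply/seteqP; split => x /=; rewrite in_itv/= andbT.
  rewrite -[X in measurable X]setTI; apply: measurable_funM => //.
  exact: measurable_funB.
have -> : [set x | (t < `|x - m|)%R] = [set x | (t < 1 * (x - m))%R] `|`
    [set x | (t < (-1) * (x - m))%R].
  apply/seteqP; split => x /=; rewrite mul1r mulN1r ltr_normr.
    by move=> /orP[]; [left|right].
  by move=> []->//; rewrite orbT.
apply: (@le_trans _ _ (normal_prob m 1 [set x | (t < 1 * (x - m))%R] +
    normal_prob m 1 [set x | (t < (-1) * (x - m))%R])%E).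
  exact: (@measureU2 _ _ _ (normal_prob m 1) _ _ (mf 1) (mf (-1))).
by rewrite mulr2n EFinD leeD// normal_prob_tail// ?expr1n// sqrrN expr1n.
Qed.

(** The mass farther than c * s from the mean vanishes as s grows and g is bounded, so only the
    values of g near m s count. *)
Lemma normal_concentration (l B c : R) (m : R -> R) (g : R -> R -> R) :
  0 <= l -> 0 < c -> (forall s, measurable_fun setT (g s)) ->
  (\forall s \near +oo, forall z, 0 <= g s z <= B) ->
  (forall e, 0 < e -> \forall s \near +oo, forall z, `|z - m s| <= c * s -> `|g s z - l| <= e) ->
  (\int[normal_prob (m s) 1]_z (g s z)%:E)%E @[s --> +oo] --> l%:E.
Proof.
move=> l0 c0 mg gB gl.
(* K dominates both g and l, hence also their difference on the exceptional set. *)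
have [K [K0 BK lK]] : exists K, [/\ 0 < K, B <= K & l <= K].
  exists (`|B| + l + 1); have := ler_norm B; have := normr_ge0 B.
  by split; lra.
have key e : 0 < e -> \forall s \near +oo,
    (l%:E <= \int[normal_prob (m s) 1]_z (g s z)%:E + e%:E)%E /\
    (\int[normal_prob (m s) 1]_z (g s z)%:E <= (l + e)%:E)%E.
  move=> e0; have e20 : 0 < e / 2 by rewrite divr_gt0.
  (* Two tails of mass e / (4 K), weighted by K, cost e / 2. *)
  have eK : 0 < e / (4 * K) by rewrite divr_gt0// mulr_gt0.
  near=> s.
  have gBs z : 0 <= g s z <= B by move: z; near: s.
  have gls z : `|z - m s| <= c * s -> `|g s z - l| <= e / 2.
    by move: z; near: s; exact: gl.
  have es : expR (1 / 2 - c * s) <= e / (4 * K) by near: s; exact: near_expR_le.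
  set N := normal_prob (m s) 1.
  pose A := [set x | (c * s < `|x - m s|)%R].
  have mA : measurable A.
    rewrite (_ : A = (fun x => `|x - m s|) @^-1` `]c * s, +oo[%classic); last first.
      by apply/seteqP; split => x /=; rewrite in_itv/= andbT.
    rewrite -[X in measurable X]setTI; apply: measurableT_comp => //.
    exact: measurable_funB.
  have NA : (K%:E * N A <= (e / 2)%:E)%E.
    apply: (@le_trans _ _ (K%:E * (e / (4 * K) *+ 2)%:E)%E).
      rewrite lee_pmul2l// (le_trans (normal_prob_dist_gt _ _))// lee_fin.
      by rewrite !mulr2n lerD.
    rewrite -EFinM lee_fin -mulr_natr le_eqVlt; apply/orP; left; apply/eqP.
    by field; rewrite gt_eqF.
  have bound (u v : R -> R) : measurable_fun setT u -> measurable_fun setT v ->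
      (forall x, 0 <= u x) -> (forall x, 0 <= v x) ->
      (forall x, u x <= v x + e / 2 + K * \1_A x) ->
      (\int[N]_x (u x)%:E <= \int[N]_x (v x)%:E + e%:E)%E.
    move=> mu_ mv u0 v0 uv.
    have mK : measurable_fun setT (fun x => K * \1_A x).
      by apply: measurable_funM => //; exact: measurable_indic.
    apply: (@le_trans _ _ (\int[N]_x ((v x)%:E + ((e / 2)%:E + (K * \1_A x)%:E)))%E).
      apply: ge0_le_integral => //.
      - by move=> x _; rewrite lee_fin.
      - exact/measurable_EFinP.
      - apply: emeasurable_funD; first exact/measurable_EFinP.
        by apply: emeasurable_funD => //; exact/measurable_EFinP.
      - by move=> x _; rewrite -!EFinD lee_fin addrA.
    rewrite ge0_integralD//; last 4 first.
    - by move=> x _; rewrite lee_fin.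
    - exact/measurable_EFinP.
    - by move=> x _; rewrite -EFinD lee_fin addr_ge0// ?(ltW e20)// mulr_ge0// ltW.
    - by apply: emeasurable_funD => //; exact/measurable_EFinP.
    apply: leeD2l; rewrite ge0_integralD//; last 3 first.
    - by move=> x _; rewrite lee_fin ltW.
    - by move=> x _; rewrite lee_fin mulr_ge0// ltW.
    - exact/measurable_EFinP.
    rewrite integral_normal_cst.
    under eq_integral do rewrite EFinM.
    rewrite ge0_integralZl//; last 2 first.
    - by apply/measurable_EFinP; exact: measurable_indic.
    - by rewrite lee_fin ltW.
    rewrite integral_indic// setIT [e in leRHS]splitr EFinD.
    exact: leeD2l.
  have pw x : l <= g s x + e / 2 + K * \1_A x /\ g s x <= l + e / 2 + K * \1_A x.
    have /andP[g0 g1] := gBs x; rewrite indicE.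
    have [xA|xA] := boolP (x \in A); first by rewrite mulr1; split; lra.
    rewrite mulr0; have : `|g s x - l| <= e / 2.
      by apply: gls; move: xA; rewrite notin_setE/= => /negP; rewrite -leNgt.
    by rewrite ler_norml => /andP[? ?]; split; lra.
  have lE : (\int[N]_x (cst l x)%:E = l%:E)%E := integral_normal_cst (m s) l.
  split.
    rewrite -{1}lE; apply: bound => // x; [by case/andP: (gBs x)|by case: (pw x)].
  rewrite EFinD -lE; apply: bound => // x; [by case/andP: (gBs x)|by case: (pw x)].
apply/fine_cvgP.
have fin : \forall s \near +oo, (\int[normal_prob (m s) 1]_z (g s z)%:E)%E \is a fin_num.
  apply: filterS2 gB (key 1 ltr01) => s g0 [_ h2].
  rewrite ge0_fin_numE ?(le_lt_trans h2) ?ltry//.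
  by apply: integral_ge0 => z _; rewrite lee_fin; case/andP: (g0 z).
split => //; apply/cvgrPdist_le => e e0.
apply: filterS2 fin (key e e0) => s fs; rewrite -(fineK fs) -EFinD !lee_fin /= => -[h1 h2].
by rewrite ler_norml; apply/andP; split; lra.
Unshelve. all: by end_near.
Qed.

End normal_tilt.

(** * Mean measure of the propagation process *)

Lemma ltr_powR2r (R : realType) (r a b : R) : 0 < r -> 0 <= a -> 0 <= b ->
  (a `^ r < b `^ r) = (a < b).
Proof.
move=> r0 a0 b0; apply/idP/idP => [|ab]; last by rewrite gt0_ltr_powR.
by apply: contraTT; rewrite -!leNgt => ba; rewrite ge0_ler_powR// ltW.
Qed.

Section propagation.
Variables (R : realType) (K beta : R).
Hypotheses (K0 : 0 < K) (beta2 : 2 < beta).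
Implicit Types (s t z : R) (x : R * R).

Let beta0 : 0 < beta. Proof. exact: lt_trans beta2. Qed.

Lemma enorm_ge0 x : 0 <= enorm x.
Proof. exact: sqrtr_ge0. Qed.

Lemma enorm_eq0 x : (enorm x == 0) = (x == (0, 0)).
Proof.
rewrite sqrtr_eq0 le_eqVlt [X in _ || X]ltNge addr_ge0 ?sqr_ge0// orbF.
by rewrite paddr_eq0 ?sqr_ge0// !sqrf_eq0; case: x.
Qed.

(* Radius below which a point of the pattern is sent below t. *)
Definition reach s t z := t `^ beta^-1 / K * expR (s * z / beta - s ^+ 2 / beta ^+ 2).

Lemma reach_gt0 s t z : 0 < t -> 0 < reach s t z.
Proof. by move=> t0; rewrite mulr_gt0 ?expR_gt0// divr_gt0// powR_gt0. Qed.

(** The exponents -s^2 (beta - 2) / (2 beta) from K(s)^beta and s^2 / 2 from the shadowing add up to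
    s^2 / beta. *)
Lemma propagationE s x z :
  propagation K beta s x z = (K * expR (s ^+ 2 / beta ^+ 2 - s * z / beta) * enorm x) `^ beta.
Proof.
have b0 : beta != 0 by rewrite gt_eqF.
rewrite /propagation /Ksigma /shadowing !powRM ?mulr_ge0 ?expR_ge0 ?enorm_ge0 ?(ltW K0)//.
rewrite -!expRM [in RHS](_ : expR (_ * beta) = expR (- (s ^+ 2 * (beta - 2) / (2 * beta ^+ 2)) * beta) /
    expR (- (s ^+ 2 / 2) + s * z)); first ring.
by rewrite -expRN -expRD; congr expR; field.
Qed.

Lemma propagation_ge0 s x z : 0 <= propagation K beta s x z.
Proof. by rewrite propagationE powR_ge0. Qed.

Lemma propagation_lt s t x z : 0 < t ->
  (propagation K beta s x z < t) = (enorm x < reach s t z).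
Proof.
move=> t0; rewrite propagationE.
have E0 : 0 < K * expR (s ^+ 2 / beta ^+ 2 - s * z / beta) by rewrite mulr_gt0 ?expR_gt0.
rewrite -[X in _ < X](powRr1 (ltW t0)) -(mulVf (lt0r_neq0 beta0)) powRrM.
rewrite ltr_powR2r ?powR_ge0 ?mulr_ge0 ?enorm_ge0 ?(ltW E0) ?(ltW K0) ?expR_ge0//.
rewrite mulrC -ltr_pdivlMr//; congr (_ < _).
rewrite /reach invfM -expRN mulrA; congr (_ * expR _); ring.
Qed.

(** With u = 2 s / beta, the exponential is exp (u z - u^2 / 2), the likelihood ratio of N(u, 1) to
    N(0, 1). *)
Lemma reach_sqr s t z : 0 < t -> reach s t z ^+ 2 =
  t `^ (2 / beta) / K ^+ 2 * expR (2 * s / beta * (z - 0) - (2 * s / beta) ^+ 2 / 2).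
Proof.
move=> t0; have b0 : beta != 0 by rewrite gt_eqF.
rewrite /reach !exprMn exprVn; congr (_ / _ * _).
  by rewrite expr2 -powRD ?(gt_eqF t0) ?implybT//; congr (_ `^ _); ring.
by rewrite -expRM_natl; congr expR; field.
Qed.

Lemma measurable_reach s t : measurable_fun setT (reach s t).
Proof.
apply: measurable_funM => //; apply: measurableT_comp => //.
by apply: measurable_funB => //; apply: measurable_funM => //; apply: measurable_funM.
Qed.

Lemma measurable_propagation s x : measurable_fun setT (propagation K beta s x).
Proof.
rewrite (_ : propagation K beta s x =
  fun z => (K * expR (s ^+ 2 / beta ^+ 2 - s * z / beta) * enorm x) `^ beta); last first.
  by apply/funext => z; rewrite propagationE.
apply: (@measurableT_comp _ _ _ _ _ _ (@powR R ^~ beta)); first exact: measurable_powR.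
apply: measurable_funM => //; apply: measurable_funM => //; apply: measurableT_comp => //.
by apply: measurable_funB => //; apply: measurable_funM => //; apply: measurable_funM.
Qed.

End propagation.

(** * Counting the pattern in disks *)

Lemma bool_series_lty (R : realType) (b : pred nat) :
  (\sum_(0 <= i <oo) ((b i)%:R : R)%:E < +oo)%E ->
  exists N, forall i, (N <= i)%N -> ~~ b i.
Proof.
move=> blty; have f0 i : (0 <= ((b i)%:R : R)%:E)%E by rewrite lee_fin.
have := nneseries_tail_cvg blty (fun i _ => f0 i).
move/fine_cvgP => [[N1 _ fin] /cvgrPdist_lt/(_ _ ltr01)[N2 _ hN]].
exists (maxn N1 N2) => i; rewrite geq_max => /andP[iN1 iN2].
apply/negP => bi.
(* A single true index would make its tail at least 1, yet the tails tend to 0. *)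
have : (1 <= \sum_(i <= k <oo) ((b k)%:R : R)%:E)%E.
  rewrite -[leLHS](_ : \sum_(i <= k < i.+1) ((b k)%:R : R)%:E = 1)%E.
    exact: nneseries_lim_ge.
  by rewrite big_nat1 bi.
have := hN i iN2; have := fin i iN1 => /= fi.
by rewrite sub0r normrN -(fineK fi) lee_fin => /(le_lt_trans (ler_norm _)); rewrite ltNge => /negP.
Qed.

Lemma bool_series_natE (R : realType) (b : pred nat) :
  (\sum_(0 <= i <oo) ((b i)%:R : R)%:E < +oo)%E ->
  exists n : nat, (\sum_(0 <= i <oo) ((b i)%:R : R)%:E = n%:R%:E)%E.
Proof.
move=> /bool_series_lty[N hN]; exists (\sum_(i < N) b i)%N.
rewrite (nneseries_split _ N)// add0n.
rewrite [X in (_ + X)%E]eseries0 ?adde0; last first.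
  by move=> i Ni _; rewrite (negbTE (hN _ Ni)).
by rewrite sumEFin big_mkord natr_sum.
Qed.

Section disk_count.
Variables (R : realType) (X : nat -> R * R).
Hypothesis lfX : locally_finite_pattern X.
Implicit Types (D : pred (R * R)) (r : R).

Definition disk_count D r : \bar R :=
  (\sum_(0 <= i <oo) ((D (X i) && (enorm (X i) < r))%:R : R)%:E)%E.

Lemma disk_count_predT r : disk_count predT r = point_measure R predT X (disk r).
Proof.
apply: eq_eseriesr => i _; rewrite /= diracE.
by congr ((nat_of_bool _)%:R%:E); apply/idP/idP; rewrite inE.
Qed.

Lemma measurable_enorm : measurable_fun setT (@enorm R).
Proof.
apply: (@measurableT_comp _ _ _ _ _ _ (@Num.sqrt R)).
  by apply: continuous_measurable_fun; exact: sqrt_continuous.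
apply: measurable_funD; apply: measurable_funX; [exact: measurable_fst|exact: measurable_snd].
Qed.

Lemma measurable_disk r : measurable (disk r).
Proof.
rewrite (_ : disk r = @enorm R @^-1` `]-oo, r[%classic); last first.
  by apply/seteqP; split => x /=; rewrite /disk/= in_itv/=.
by rewrite -[X in measurable X]setTI; apply: measurable_enorm.
Qed.

Lemma bounded_disk r : bounded_set (disk r).
Proof.
exists `|r|; split; first exact: num_real.
move=> M rM [x1 x2]; rewrite /disk /enorm/= => xr.
have {}xr := ltW (lt_trans (lt_le_trans xr (ler_norm r)) rM).
have M0 : 0 <= M by rewrite (le_trans (normr_ge0 r))// ltW.
have h (u v : R) : Num.sqrt (u ^+ 2 + v ^+ 2) <= M -> `|u| <= M.
  move=> uv; apply: le_trans uv; rewrite -sqrtr_sqr ler_wsqrtr// lerDl sqr_ge0//.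
rewrite ge_max (h x1 x2 xr)//= (h x2 x1)// addrC//.
Qed.

Lemma disk_count_lty D r : (disk_count D r < +oo)%E.
Proof.
apply: (@le_lt_trans _ _ (disk_count predT r)).
  by apply: lee_nneseries => i _; rewrite lee_fin ?ler_nat//; case: (D _) => //=.
rewrite disk_count_predT; apply: lfX; [exact: measurable_disk|exact: bounded_disk].
Qed.

Definition disk_num D r : R := fine (disk_count D r).

Lemma disk_count_ge0 D r : (0 <= disk_count D r)%E.
Proof. by apply: nneseries_ge0 => i _ _; rewrite lee_fin. Qed.

Lemma disk_countE D r : disk_count D r = (disk_num D r)%:E.
Proof. by rewrite fineK// ge0_fin_numE ?disk_count_ge0// disk_count_lty. Qed.

Lemma disk_num_ge0 D r : 0 <= disk_num D r.
Proof. exact/fine_ge0/disk_count_ge0. Qed.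

Lemma disk_num_le D D' r r' :
  (forall i, D (X i) -> enorm (X i) < r -> D' (X i) /\ enorm (X i) < r') ->
  disk_num D r <= disk_num D' r'.
Proof.
move=> h; rewrite -lee_fin -!disk_countE.
apply: lee_nneseries => i _; rewrite lee_fin ?ler_nat//.
by have [|//] := boolP (_ && _) => /andP[/h/[apply] -[-> ->]].
Qed.

Lemma disk_num_add D D1 D2 r r1 r2 :
  (forall i, D (X i) -> enorm (X i) < r -> (D1 (X i) /\ enorm (X i) < r1) \/
      (D2 (X i) /\ enorm (X i) < r2)) ->
  disk_num D r <= disk_num D1 r1 + disk_num D2 r2.
Proof.
move=> h; rewrite -lee_fin EFinD -!disk_countE.
rewrite -nneseriesD; last 2 first.
- by move=> i _ _; rewrite lee_fin.
- by move=> i _ _; rewrite lee_fin.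
apply: lee_nneseries => i _; rewrite -?EFinD lee_fin// -natrD ler_nat.
by have [|//] := boolP (_ && _) => /andP[/h/[apply] -[] [-> ->]]//; rewrite addn1.
Qed.

(** Only finitely many indices have their point in the unit disk, so a minimum of finitely many
    positive norms works. *)
Lemma enorm_gap : exists2 r0, 0 < r0 & forall i, X i != (0, 0) -> r0 <= enorm (X i).
Proof.
have [N hN] : exists N, forall i, (N <= i)%N -> 1 <= enorm (X i).
  have [N hN] := bool_series_lty (disk_count_lty predT 1).
  by exists N => i /hN /=; rewrite -leNgt.
have : exists2 r0, 0 < r0 & forall i, (i < N)%N -> X i != (0, 0) -> r0 <= enorm (X i).
  elim: N {hN} => [|n [r r0 hr]]; first by exists 1.
  have [Xn|Xn] := eqVneq (X n) (0, 0).
    exists r => // i; rewrite ltnS leq_eqVlt => /predU1P[->|]; last exact: hr.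
    by rewrite Xn eqxx.
  exists (Num.min r (enorm (X n))).
    by rewrite lt_min r0 lt_neqAle eq_sym enorm_eq0 Xn enorm_ge0.
  move=> i; rewrite ltnS leq_eqVlt => /predU1P[->|iN] Xi; rewrite ge_min ?lexx ?orbT//.
  by rewrite hr.
move=> [r r0 hr]; exists (Num.min r 1); first by rewrite lt_min r0 ltr01.
move=> i Xi; rewrite ge_min; have [iN|Ni] := ltnP i N; first by rewrite hr.
by rewrite hN// orbT.
Qed.

Variable lambda : R.
Hypothesis lambda0 : 0 < lambda.
Hypothesis homX : empirically_homogeneous lambda X.

Lemma disk_num_homogeneous e : 0 < e ->
  \forall r \near +oo, `|disk_num predT r - lambda * pi * r ^+ 2| <= e * r ^+ 2.
Proof.
move=> e0; have ep : 0 < e / pi by rewrite divr_gt0// pi_gt0.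
move/fine_cvgP : homX => [_ /cvgrPdist_le/(_ _ ep)] H.
near=> r; have r0 : 0 < r by near: r; exact: nbhs_pinfty_gt.
have : `|lambda - fine (point_measure R predT X (disk r) * ((pi * r ^+ 2)^-1)%:E)%E| <= e / pi.
  by near: r.
rewrite -disk_count_predT disk_countE -EFinM/= => h.
have pr : 0 < pi * r ^+ 2 by rewrite mulr_gt0 ?pi_gt0// exprn_gt0.
have -> : disk_num predT r - lambda * pi * r ^+ 2 =
    - ((lambda - disk_num predT r / (pi * r ^+ 2)) * (pi * r ^+ 2)).
  have rn : r != 0 by rewrite gt_eqF.
  have pn : pi != 0 :> R by rewrite gt_eqF ?pi_gt0.
  move: pn; generalize (pi : R) => p pn.
  by field; rewrite rn pn.
rewrite normrN normrM (gtr0_norm pr).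
apply: le_trans (ler_wpM2r (ltW pr) h) _.
by rewrite mulrA divfK// gt_eqF ?pi_gt0.
Unshelve. all: by end_near.
Qed.

(** Homogeneity controls the large radii and monotonicity of the count the others. *)
Lemma disk_num_growth : exists2 B, 0 < B & forall r, 0 < r -> disk_num predT r <= B * (1 + r ^+ 2).
Proof.
have [M [_ hM]] := disk_num_homogeneous ltr01.
pose r1 := Num.max M 0 + 1.
have Mr1 : M < r1 by rewrite /r1 ltr_pwDr// le_max lexx.
have lp : 0 <= lambda * pi by rewrite mulr_ge0 ?(ltW lambda0)// pi_ge0.
have A0 := disk_num_ge0 predT r1.
exists (lambda * pi + 1 + disk_num predT r1) => [|r r0]; first by rewrite ltr_pwDl// ltr_wpDl.
have r20 := sqr_ge0 r.
have [Mr|rM] := ltP M r.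
  by have := hM r Mr; rewrite ler_norml => /andP[_]; nra.
apply: (@le_trans _ _ (disk_num predT r1)); last by nra.
by apply: disk_num_le => i _ h; split => //; apply: lt_trans h _; apply: le_lt_trans Mr1.
Qed.

(** Without the origin the count is 0 up to the gap r0, and beyond it 1 <= r^2 / r0^2 absorbs the
    constant. This bounds the count divided by r^2 for all radii and all D at once. *)
Lemma disk_num_growth0 : exists2 B, 0 < B & forall D r, 0 < r ->
  (forall i, D (X i) -> X i != (0, 0)) -> disk_num D r <= B * r ^+ 2.
Proof.
have [r0 r00 hr0] := enorm_gap.
have [B B0 hB] := disk_num_growth.
exists (B * (r0 ^- 2 + 1)) => [|D r r_gt0 hD].
  by rewrite mulr_gt0// addr_gt0// invr_gt0 exprn_gt0.
have [rr0|r0r] := leP r r0.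
  rewrite (_ : disk_num D r = 0).
    by rewrite mulr_ge0 ?sqr_ge0// mulr_ge0 ?(ltW B0)// addr_ge0// invr_ge0 sqr_ge0.
  rewrite /disk_num /disk_count eseries0// => i _ _.
  have [|//] := boolP (_ && _) => /andP[/hD/hr0 h1 h2].
  by have := lt_le_trans h2 rr0; rewrite ltNge h1.
apply: (@le_trans _ _ (B * (1 + r ^+ 2))).
  apply: le_trans (hB _ r_gt0); exact: disk_num_le.
rewrite -mulrA ler_pM2l// mulrDl mul1r lerD2r.
have r0s : 0 < r0 ^+ 2 by rewrite exprn_gt0.
by rewrite mulrC ler_pdivlMr// mul1r ler_sqr ?nnegrE ltW.
Qed.

End disk_count.

(** * Expected counts and hitting probabilities *)

Section mean_measure.
Variables (R : realType) (K beta : R) (X : nat -> R * R) (lambda : R).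
Hypotheses (K0 : 0 < K) (beta2 : 2 < beta) (lambda0 : 0 < lambda).
Hypotheses (lfX : locally_finite_pattern X) (homX : empirically_homogeneous lambda X).
Implicit Types (s t z r : R) (D : pred (R * R)).

Let beta0 : 0 < beta. Proof. exact: lt_trans beta2. Qed.

(** A set of values of the normal variable, empty for a discarded point: full and restricted
    processes are thus both counts of hits by the same independent variables. *)
Definition hit_set D s (B : set R) (i : nat) : set R :=
  [set z | D (X i) /\ B (propagation K beta s (X i) z)].

Lemma measurable_hit_set D s B i : measurable B -> measurable (hit_set D s B i).
Proof.
move=> mB; rewrite /hit_set; case: (D (X i)).
  rewrite (_ : [set z | _] = propagation K beta s (X i) @^-1` B).
    by rewrite -[X in measurable X]setTI; apply: measurable_propagation.
  by apply/seteqP; split => z // -[].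
by rewrite (_ : [set z | _] = set0)//; apply/seteqP; split => z // -[].
Qed.

Definition mean_count D s (B : set R) : \bar R :=
  (\sum_(0 <= i <oo) normal_prob 0 1 (hit_set D s B i))%E.

Lemma measurable_reach_indic D s t i : measurable_fun setT
  (fun z => (D (X i) && (enorm (X i) < reach K beta s t z))%:R : R).
Proof.
case: (D (X i)) => /=; last exact: measurable_cst.
rewrite (_ : (fun z => _) = \1_(reach K beta s t @^-1` `]enorm (X i), +oo[%classic)).
  apply: measurable_indic; rewrite -[X in measurable X]setTI.
  by apply: measurable_reach.
apply/funext => z; rewrite indicE; congr (nat_of_bool _)%:R.
by apply/idP/idP; rewrite inE/= in_itv/= andbT.
Qed.

(** By linearity only the marginal laws matter, so one normal variable can serve all points; summing
    inside the integral counts the points within its reach. *)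
Lemma mean_count_integral D s t : 0 < t ->
  mean_count D s `[0, t[%classic =
  (\int[normal_prob 0 1]_z (disk_num X D (reach K beta s t z))%:E)%E.
Proof.
move=> t0.
under eq_integral do rewrite -disk_countE//.
rewrite /disk_count integral_nneseries//; last first.
  by move=> i; apply/measurable_EFinP; exact: measurable_reach_indic.
apply: eq_eseriesr => i _.
have m1 := @measurable_hit_set D s `[0, t[%classic i (measurable_itv _).
rewrite -[X in normal_prob 0 1 X]setIT -(integral_indic _ measurableT)//.
apply: eq_integral => z _; congr (_%:E); rewrite indicE; congr (nat_of_bool _)%:R.
apply/idP/idP; rewrite inE/hit_set/= in_itv/= propagation_ge0//= propagation_lt//.
  by move=> [-> ->].
by move/andP.
Qed.

Lemma mean_count_ge0 D s B : (0 <= mean_count D s B)%E.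
Proof. by apply: nneseries_ge0. Qed.

Lemma measurable_disk_num_reach D s t :
  measurable_fun setT (fun z => disk_num X D (reach K beta s t z)).
Proof.
apply/measurable_EFinP; rewrite (_ : _ \o _ = fun z => disk_count X D (reach K beta s t z)).
  apply: ge0_emeasurable_sum => // i _; apply/measurable_EFinP.
  exact: measurable_reach_indic.
by apply/funext => z /=; rewrite disk_countE.
Qed.

Lemma measurable_disk_ratio D s t : measurable_fun setT
  (fun z => disk_num X D (reach K beta s t z) / reach K beta s t z ^+ 2).
Proof.
apply: measurable_funM; first exact: measurable_disk_num_reach.
rewrite (_ : (fun z => _) = (fun z => (t `^ beta^-1 / K) ^- 2 *
    expR (- (s * z / beta - s ^+ 2 / beta ^+ 2)) ^+ 2)); last first.
  by apply/funext => z; rewrite /reach expRN exprVn exprMn invfM.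
apply: measurable_funM => //; apply: measurable_funX; apply: measurableT_comp => //.
apply: measurableT_comp => //.
by apply: measurable_funB => //; apply: measurable_funM => //; apply: measurable_funM.
Qed.

Let c t := t `^ (2 / beta) / K ^+ 2.
Let m s := 2 * s / beta.

(* The factor reach ^+ 2 is absorbed as the likelihood ratio of the shifted normal
   law. *)
Lemma mean_count_tilt D s t : 0 < t ->
  mean_count D s `[0, t[%classic = ((c t)%:E *
  \int[normal_prob (m s) 1]_z
    (disk_num X D (reach K beta s t z) / reach K beta s t z ^+ 2)%:E)%E.
Proof.
move=> t0; rewrite mean_count_integral//.
have c0 : 0 < c t by rewrite divr_gt0 ?powR_gt0// exprn_gt0.
have r2 z : 0 < reach K beta s t z ^+ 2 by rewrite exprn_gt0// reach_gt0.
pose g z := disk_num X D (reach K beta s t z) / reach K beta s t z ^+ 2.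
have g0 z : (0 <= (g z)%:E)%E by rewrite lee_fin divr_ge0 ?disk_num_ge0// ltW.
have mg : measurable_fun setT (EFin \o g).
  by apply/measurable_EFinP; exact: (measurable_disk_ratio D s t).
pose E z := ((expR (m s * (z - 0) - m s ^+ 2 / 2))%:E * (EFin \o g) z)%E.
have mE : measurable_fun setT E.
  apply: emeasurable_funM => //; apply/measurable_EFinP; apply: measurableT_comp => //.
  by apply: measurable_funB => //; apply: measurable_funM => //; apply: measurable_funB.
have E0 z : setT z -> (0 <= E z)%E by move=> _; apply: mule_ge0; [rewrite lee_fin expR_ge0|exact: g0].
have c0E : (0 <= (c t)%:E)%E by rewrite lee_fin ltW.
transitivity ((c t)%:E * \int[normal_prob 0 1]_z E z)%E; last first.
  by rewrite (integral_normal_tilt 0 (m s) mg g0) add0r.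
rewrite -(ge0_integralZl (normal_prob 0 1) measurableT mE E0 c0E).
apply: eq_integral => z _; rewrite /E/= -!EFinM; congr (_%:E).
by rewrite mulrA -reach_sqr// /g mulrC divfK// gt_eqF.
Qed.

Lemma mean_count_set0 D s t : t <= 0 -> mean_count D s `[0, t[%classic = 0%E.
Proof.
move=> t0; rewrite /mean_count eseries0// => i _ _.
rewrite (_ : hit_set _ _ _ _ = set0) ?measure0//.
apply/seteqP; split => // z [_]/=; rewrite in_itv/= => /andP[h1 h2].
by have := le_lt_trans h1 (lt_le_trans h2 t0); rewrite ltxx.
Qed.

(** Here D may keep the origin, hence the bound B (1 + r^2); the integral of reach ^+ 2 is [c t], as
    a likelihood ratio integrates to 1. *)
Lemma mean_count_lty D s t : (mean_count D s `[0%R, t[%classic < +oo)%E.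
Proof.
have [t0|t0] := leP t 0; first by rewrite mean_count_set0.
rewrite mean_count_integral//.
have [B B0 hB] := disk_num_growth lfX lambda0 homX.
have c0 : 0 < c t by rewrite divr_gt0 ?powR_gt0// exprn_gt0.
pose E z := ((expR (m s * (z - 0) - m s ^+ 2 / 2))%:E * (B * c t)%:E)%E.
have E0 z : (0 <= E z)%E by rewrite mule_ge0// lee_fin ?expR_ge0// mulr_ge0// ltW.
have mE : measurable_fun setT E.
  apply: emeasurable_funM => //; apply/measurable_EFinP; apply: measurableT_comp => //.
  by apply: measurable_funB => //; apply: measurable_funM => //; apply: measurable_funB.
apply: (@le_lt_trans _ _ (\int[normal_prob 0 1]_z (B%:E + E z))%E).
  apply: ge0_le_integral => //.
  - by move=> z _; rewrite lee_fin disk_num_ge0.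
  - by apply/measurable_EFinP; exact: (measurable_disk_num_reach D s t).
  - exact: emeasurable_funD.
  - move=> z _; rewrite /E -EFinM -EFinD lee_fin.
    have r0 : 0 < reach K beta s t z by rewrite reach_gt0.
    apply: (@le_trans _ _ (disk_num X predT (reach K beta s t z))).
      exact: disk_num_le.
    apply: le_trans (hB _ r0) _; rewrite mulrDr mulr1 lerD2l reach_sqr// le_eqVlt.
    by apply/orP; left; apply/eqP; rewrite /c /m; ring.
rewrite ge0_integralD//; last by move=> z _; rewrite lee_fin ltW.
rewrite integral_normal_cst.
have Bc z : (0 <= cst (B * c t)%:E z)%E by rewrite lee_fin mulr_ge0// ltW.
rewrite (integral_normal_tilt 0 (m s) (measurable_cst _) Bc).
by rewrite integral_normal_cst -EFinD ltry.
Qed.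

Lemma near_sqr_ge (a b : R) : 0 < b -> \forall s \near +oo, a <= b * s ^+ 2.
Proof.
move=> b0; near=> s.
have s1 : 1 <= s by near: s; exact: nbhs_pinfty_ge.
have : a / b <= s by near: s; apply: nbhs_pinfty_ge; exact: num_real.
rewrite ler_pdivrMr// => /le_trans; apply; rewrite mulrC ler_pM2l// expr2 ler_peMr//.
Unshelve. all: by end_near.
Qed.

(** Homogeneity is asked only at radii between two exponentials of s^2, where it holds for the whole
    pattern and for the annulus alike, so one argument serves both processes. *)
Lemma cvg_mean_count (D : R -> pred (R * R)) :
  (\forall s \near +oo, forall i, D s (X i) -> X i != (0, 0)) ->
  (forall b b' e, 0 < b -> 0 < e -> \forall s \near +oo, forall r,
    expR (b * s ^+ 2) <= r -> r <= expR (b' * s ^+ 2) ->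
    `|disk_num X (D s) r / r ^+ 2 - lambda * pi| <= e) ->
  forall t, 0 <= t ->
  mean_count (D s) s `[0, t[%classic @[s --> +oo] -->
    (lambda * pi / K ^+ 2 * t `^ (2 / beta))%:E.
Proof.
move=> D0 DH t; rewrite le_eqVlt => /predU1P[<-|t0].
  rewrite powR0 ?mulr0; last by rewrite mulf_neq0// ?invr_neq0// gt_eqF.
  by apply: cvg_near_cst; apply: nearW => s; rewrite mean_count_set0.
have [B B0 hB] := disk_num_growth0 lfX lambda0 homX.
under eq_fun do rewrite mean_count_tilt//.
rewrite (_ : lambda * pi / K ^+ 2 * t `^ (2 / beta) = c t * (lambda * pi)); last first.
  by rewrite /c; ring.
rewrite EFinM; apply: cvgeZl => //.
apply: (@normal_concentration R (lambda * pi) B (1 / (2 * beta))).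
- by rewrite mulr_ge0 ?pi_ge0// ltW.
- by rewrite divr_gt0// mulr_gt0.
- by move=> s; exact: measurable_disk_ratio.
- apply: filterS D0 => s Ds z.
  have r0 : 0 < reach K beta s t z by rewrite reach_gt0.
  rewrite divr_ge0 ?disk_num_ge0 ?sqr_ge0//= ler_pdivrMr ?exprn_gt0//.
  exact: hB.
move=> e e0.
(* Let Q = s^2 / beta^2, the value of the exponent of reach at the tilted mean. The window of
   half-width s / (2 beta) moves it by at most Q / 2, and |ln (t^(1/beta) / K)| is eventually at
   most Q / 4, so ln (reach) lies between Q / 4 and 2 Q. *)
pose b := 1 / (4 * beta ^+ 2); pose b' := 2 / beta ^+ 2.
have b0 : 0 < b by rewrite divr_gt0// mulr_gt0// exprn_gt0.
have r10 : 0 < t `^ beta^-1 / K by rewrite divr_gt0// powR_gt0.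
near=> s; move=> z hz.
have s0 : 0 < s by near: s; exact: nbhs_pinfty_gt.
have hs : `|ln (t `^ beta^-1 / K)| <= b * s ^+ 2 by near: s; exact: near_sqr_ge.
have H : forall r, expR (b * s ^+ 2) <= r -> r <= expR (b' * s ^+ 2) ->
    `|disk_num X (D s) r / r ^+ 2 - lambda * pi| <= e by near: s; exact: DH.
have rE : reach K beta s t z = expR (ln (t `^ beta^-1 / K) + (s * z / beta - s ^+ 2 / beta ^+ 2)).
  by rewrite expRD lnK.
have E1 : s * z / beta - s ^+ 2 / beta ^+ 2 = s ^+ 2 / beta ^+ 2 + s / beta * (z - m s).
  by rewrite /m; field; rewrite gt_eqF.
have E2 : `|s / beta * (z - m s)| <= s ^+ 2 / (2 * beta ^+ 2).
  rewrite normrM gtr0_norm ?divr_gt0//.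
  apply: (@le_trans _ _ (s / beta * (1 / (2 * beta) * s))).
    by rewrite ler_wpM2l// ltW// divr_gt0.
  by rewrite le_eqVlt; apply/orP; left; apply/eqP; field; rewrite gt_eqF.
have Q0 : 0 < s ^+ 2 / beta ^+ 2 by rewrite divr_gt0 ?exprn_gt0.
have Q1 : s ^+ 2 / (2 * beta ^+ 2) = (s ^+ 2 / beta ^+ 2) / 2 by field; rewrite gt_eqF.
have Q2 : b * s ^+ 2 = (s ^+ 2 / beta ^+ 2) / 4 by rewrite /b; field; rewrite gt_eqF.
have Q3 : b' * s ^+ 2 = 2 * (s ^+ 2 / beta ^+ 2) by rewrite /b'; field; rewrite gt_eqF.
by move: hs E2; rewrite Q1 Q2 => hs E2; apply: H; rewrite rE ler_expR E1 ?Q2 ?Q3;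
  move: hs E2; rewrite !ler_norml => /andP[? ?] /andP[? ?]; lra.
Unshelve. all: by end_near.
Qed.

(** A retained point has norm at least r0, so hitting below t requires reach > r0, hence z > s / (2
    beta) for large s. This event does not depend on i. *)
Lemma hit_prob_small (D : R -> pred (R * R)) t :
  (\forall s \near +oo, forall i, D s (X i) -> X i != (0, 0)) ->
  forall e, 0 < e -> \forall s \near +oo, forall i,
    (normal_prob 0 1 (hit_set (D s) s `[0%R, t[%classic i) <= e%:E)%E.
Proof.
move=> D0 e e0.
have [r0 r00 hr0] := enorm_gap lfX.
have [t0|t0] := leP t 0.
  apply: nearW => s i.
  rewrite (_ : hit_set _ _ _ _ = set0) ?measure0 ?lee_fin ?(ltW e0)//.
  apply/seteqP; split => // z [_]/=; rewrite in_itv/= => /andP[h1 h2].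
  by have := le_lt_trans h1 (lt_le_trans h2 t0); rewrite ltxx.
have r10 : 0 < t `^ beta^-1 / K by rewrite divr_gt0// powR_gt0.
near=> s; move=> i.
have s0 : 0 < s by near: s; exact: nbhs_pinfty_gt.
have hs : ln (t `^ beta^-1 / K) - ln r0 <= 1 / (2 * beta ^+ 2) * s ^+ 2.
  by near: s; apply: near_sqr_ge; rewrite divr_gt0// mulr_gt0// exprn_gt0.
have es : expR (1 / 2 - 1 / (2 * beta) * s) <= e.
  by near: s; apply: near_expR_le => //; rewrite divr_gt0// mulr_gt0.
have Ds : forall i, D s (X i) -> X i != (0, 0) by near: s.
apply: (@le_trans _ _ (normal_prob 0 1 [set z | (1 / (2 * beta) * s < 1 * (z - 0))%R])).
  apply: le_measure; rewrite ?inE.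
  - exact: measurable_hit_set.
  - rewrite (_ : [set z | _] = (fun z => 1 * (z - 0)) @^-1` `]1 / (2 * beta) * s, +oo[%classic).
      rewrite -[X in measurable X]setTI; apply: measurable_funM => //.
      exact: measurable_funB.
    by apply/seteqP; split => z /=; rewrite in_itv/= andbT.
  - move=> z [/Ds/hr0 rX] /=; rewrite in_itv/= => /andP[_].
    rewrite propagation_lt// => /(le_lt_trans rX) h0.
    have : ln r0 < ln (reach K beta s t z) by rewrite ltr_ln ?posrE ?reach_gt0.
    rewrite lnM ?posrE ?expR_gt0// expRK mul1r subr0 => h.
    have E1 : s * z / beta - s ^+ 2 / beta ^+ 2 - 1 / (2 * beta ^+ 2) * s ^+ 2 * (-1) =
        s / beta * (z - 1 / (2 * beta) * s) by field; rewrite gt_eqF.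
    have : 0 < s / beta * (z - 1 / (2 * beta) * s) by rewrite -E1; lra.
    by rewrite pmulr_rgt0 ?divr_gt0// subr_gt0 !mul1r.
apply: le_trans (normal_prob_tail _ _ _) _; first by rewrite expr1n.
by rewrite lee_fin.
Unshelve. all: by end_near.
Qed.

End mean_measure.

(** * Convergence of the propagation process *)

Section propagation_process.
Variables (d : measure_display) (Omega : measurableType d) (R : realType).
Variables (P : probability Omega R) (K beta : R) (X : nat -> R * R).
Variables (Z : nat -> {RV P >-> R}) (lambda : R).
Hypotheses (K0 : 0 < K) (beta2 : 2 < beta) (lambda0 : 0 < lambda).
Hypotheses (lfX : locally_finite_pattern X) (homX : empirically_homogeneous lambda X).
Hypothesis iidZ : iid_standard_normal Z.
Implicit Types (D : pred (R * R)) (B : set R).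

Lemma propagation_measureE D s (z : nat -> R) B :
  propagation_measure K beta s D X z B =
  (\sum_(0 <= i <oo) (\1_(hit_set K beta X D s B i) (z i) : R)%:E)%E.
Proof.
apply: eq_eseriesr => i _; rewrite indicE.
have [Di|/negbTE Di] := boolP (D (X i)).
  rewrite /= diracE; congr ((nat_of_bool _)%:R%:E).
  by apply/idP/idP; rewrite !inE/hit_set/=; [|case].
by rewrite /mzero/= memNset// => -[]; rewrite Di.
Qed.

(** Countably many intervals suffice: a bounded set lies in ]-oo, 0[, which has mass 0, together
    with some [0, n[, and a finite series of zeros and ones is a natural number. *)
Lemma propagation_measure_lfcount D s (z : nat -> R) :
  (forall n : nat, (propagation_measure K beta s D X z `[0%R, n%:R[%classic < +oo)%E) ->
  is_lfcount (propagation_measure K beta s D X z).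
Proof.
move=> h; set mu := propagation_measure K beta s D X z.
have neg0 : mu `]-oo, 0%R[%classic = 0%E.
  rewrite /mu propagation_measureE eseries0// => i _ _.
  rewrite indicE memNset// => -[_]/=; rewrite in_itv/= ltNge.
  by rewrite propagation_ge0.
split=> // B mB [M [_ /(_ (`|M| + 1))]].
rewrite (le_lt_trans (ler_norm _)) ?ltrDl// => /(_ isT) BM.
rewrite /mu propagation_measureE; apply: bool_series_natE.
rewrite -[X in (X < _)%E](propagation_measureE D s z B).
pose n := (Num.truncn (`|M| + 1)).+1.
apply: (@le_lt_trans _ _ (mu (`]-oo, 0%R[ `|` `[0%R, n%:R[%classic)%classic)).
  apply: le_measure; rewrite ?inE//; first exact: measurableU.
  move=> x /BM; rewrite /= !in_itv/= => xM.
  have xn : x < n%:R by rewrite (le_lt_trans (le_trans (ler_norm _) xM))// truncnS_gt.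
  by have [x0|x0] := ltP x 0; [left|right; rewrite xn].
apply: (@le_lt_trans _ _ (mu `]-oo, 0%R[%classic + mu `[0%R, n%:R[%classic)%E).
  exact: measureU2.
by rewrite neg0 add0e; exact: h.
Qed.

Lemma measurable_propagation_measure D s B : measurable B ->
  measurable_fun setT (fun w => propagation_measure K beta s D X (fun i => Z i w) B).
Proof.
move=> mB; under eq_fun do rewrite propagation_measureE.
apply: ge0_emeasurable_sum => // i _; apply/measurable_EFinP.
apply: measurableT_comp => //; apply: measurable_indic; exact: measurable_hit_set.
Qed.

Let lf_event D s : set Omega :=
  [set w | is_lfcount (propagation_measure K beta s D X (fun i => Z i w))].

Let measurable_lf_event D s : measurable (lf_event D s).
Proof.
rewrite (_ : lf_event D s = \bigcap_n
  ((fun w => propagation_measure K beta s D X (fun i => Z i w) `[0%R, n%:R[%classic)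
    @^-1` [set x | (x < +oo)%E])).
  apply: bigcapT_measurable => n; rewrite -[X in measurable X]setTI.
  apply: measurable_propagation_measure => //.
  rewrite (_ : [set x | (x < +oo)%E] = ~` [set +oo%E]); last first.
    by apply/seteqP; split => x /=; rewrite ltey => /eqP.
  by apply: measurableC; exact: emeasurable_set1.
apply/seteqP; split => w /=.
  by move=> [_ h] n _ /=; have [|k ->] := h `[0, n%:R[%classic (measurable_itv _);
    [exact: bounded_itvco|rewrite ltry].
by move=> h; apply: propagation_measure_lfcount => n; exact: h.
Qed.

(** Falling back to the null measure is multiplication by an indicator, thanks to oo * 0 = 0;
    measurability of the process follows. *)
Lemma propagation_processE D s w B :
  propagation_process K beta (fun=> D) X Z s w B =
  (propagation_measure K beta s D X (fun i => Z i w) B * (\1_(lf_event D s) w)%:E)%E.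
Proof.
rewrite /propagation_process /to_lfcount; case: pselect => h; rewrite indicE.
  by rewrite mem_set// mule1.
by rewrite memNset// mule0.
Qed.

Lemma propagation_point_process D s :
  point_process (propagation_process K beta (fun=> D) X Z s).
Proof.
move=> B mB; under eq_fun do rewrite propagation_processE.
apply: emeasurable_funM; first exact: measurable_propagation_measure.
by apply/measurable_EFinP; exact: measurable_indic.
Qed.

Let hit_probE D s B i : measurable B ->
  P (Z i @^-1` hit_set K beta X D s B i) = normal_prob 0 1 (hit_set K beta X D s B i).
Proof.
by move=> mB; have [_ h] := iidZ; rewrite -(h i)//; exact: measurable_hit_set.
Qed.

Lemma expected_propagation D s B : measurable B ->
  (\int[P]_w propagation_measure K beta s D X (fun i => Z i w) B =
   mean_count K beta X D s B)%E.
Proof.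
move=> mB; under eq_integral do rewrite propagation_measureE.
rewrite integral_nneseries//; last first.
  move=> i; apply/measurable_EFinP; apply: measurableT_comp => //.
  by apply: measurable_indic; exact: measurable_hit_set.
apply: eq_eseriesr => i _; rewrite -hit_probE//.
have mh : measurable (Z i @^-1` hit_set K beta X D s B i).
  by apply: measurable_RV_preimage; exact: measurable_hit_set.
by rewrite -[X in P X]setIT -(integral_indic _ measurableT).
Qed.

(** A count with finite mean is almost surely finite, here for all [0, n[ simultaneously. *)
Lemma propagation_lf_ae D s :
  {ae P, forall w, is_lfcount (propagation_measure K beta s D X (fun i => Z i w))}.
Proof.
have H n : {ae P, forall w, (propagation_measure K beta s D X (fun i => Z i w)
    `[0%R, n%:R[%classic < +oo)%E}.
  have : P.-integrable setT (fun w =>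
      propagation_measure K beta s D X (fun i => Z i w) `[0%R, n%:R[%classic).
    apply/integrableP; split; first exact: measurable_propagation_measure.
    under eq_integral do rewrite gee0_abs//.
    rewrite expected_propagation//; exact: (mean_count_lty _ _ lambda0).
  by move/(integrable_ae measurableT); apply: filterS => w /(_ I); rewrite ge0_fin_numE.
have := @ae_foralln _ _ _ P _ H.
by apply: filterS => w; exact: propagation_measure_lfcount.
Qed.

Lemma mean_count_additive D s (a b : R) : 0 <= a <= b ->
  (mean_count K beta X D s `[0%R, b[%classic =
   mean_count K beta X D s `[0%R, a[%classic + mean_count K beta X D s `[a, b[%classic)%E.
Proof.
move=> /andP[a0 ab]; rewrite /mean_count -nneseriesD//.
apply: eq_eseriesr => i _.
rewrite (_ : hit_set K beta X D s `[0, b[%classic i =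
    hit_set K beta X D s `[0, a[%classic i `|` hit_set K beta X D s `[a, b[%classic i); last first.
  have -> : `[0, b[%classic = (`[0, a[ `|` `[a, b[)%classic :> set R.
    by rewrite -itv_bndbnd_setU// bnd_simp.
  by apply/seteqP; split => z /=; [move=> [Dz []]; [left|right]|move=> [] [Dz ?]; split => //; [left|right]].
rewrite measureU//; [exact: measurable_hit_set|exact: measurable_hit_set|].
apply/seteqP; split => // z [] [_ /=]; rewrite in_itv/= => /andP[_ za] [_ /=].
by rewrite in_itv/= => /andP[/le_lt_trans/(_ za)]; rewrite ltxx.
Qed.

Variables (d' : measure_display) (Omega' : measurableType d').
Variables (P' : probability Omega' R) (N : Omega' -> lfcount R).
Variable Lambda : {measure set R -> \bar R}.
Hypothesis LambdaE : forall t : R, 0 <= t ->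
  Lambda `[0, t[%classic = (lambda * pi / K ^+ 2 * t `^ (2 / beta))%:E.
Hypothesis poissonN : poisson_process P' N Lambda.

Lemma Lambda_itv (a b : R) : 0 <= a <= b ->
  Lambda `[a, b[%classic = (fine (Lambda `[0%R, b[%classic) - fine (Lambda `[0%R, a[%classic))%:E.
Proof.
move=> /andP[a0 ab]; have b0 := le_trans a0 ab.
have : Lambda `[0%R, b[%classic = (Lambda `[0%R, a[%classic + Lambda `[a, b[%classic)%E.
  have -> : `[0%R, b[%classic = (`[0, a[ `|` `[a, b[)%classic :> set R.
    by rewrite -itv_bndbnd_setU// bnd_simp.
  rewrite measureU//; apply/seteqP; split => // z [] /=; rewrite !in_itv/= => /andP[_ za].
  by move=> /andP[/le_lt_trans/(_ za)]; rewrite ltxx.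
rewrite !LambdaE//=; case: (Lambda _) => [r|//|//].
by rewrite -EFinD => -[->]; rewrite addrAC subrr add0r.
Qed.

Lemma poisson_cell_counts n (k : {ffun 'I_(n * 2 ^ n) -> nat}) :
  fine (P' [set w | cell_counts n (N w) = k]) =
  \prod_(j < n * 2 ^ n) (fine (Lambda (cell n j)) ^+ k j / (k j)`!%:R * expR (- fine (Lambda (cell n j)))).
Proof.
have [_ /(_ _ (fun j : 'I_(n * 2 ^ n) => cell n j) k)] := poissonN.
rewrite (_ : \bigcap_i _ = [set w | cell_counts n (N w) = k]); last first.
  by apply/seteqP; split => w /=; [move=> h; apply/cell_countsE => j; exact: h|
    move=> /cell_countsE h j _; exact: h].
move=> -> //; last exact: trivIset_cell.
by move=> j; split; [exact: measurable_cell|exact: bounded_itvco|exact: cell_subset].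
Qed.

(** Process and raw sum of indicators differ only on the null event where local finiteness fails, so
    the limit theorem for null arrays applies to the latter. *)
Lemma cell_counts_prob D s n (k : {ffun 'I_(n * 2 ^ n) -> nat}) :
  P [set w | cell_counts n (propagation_process K beta (fun=> D) X Z s w) = k] =
  P [set w | forall j, (\sum_(0 <= i <oo)
    (\1_(hit_set K beta X D s (cell n (nat_of_ord j)) i) (Z i w))%:E = ((k j)%:R : R)%:E)%E].
Proof.
set A := [set w | _]; set B := [set w | _].
have mA : measurable A by apply: measurable_cell_counts; exact: propagation_point_process.
have mB : measurable B.
  rewrite (_ : B = \bigcap_(j in [set: 'I_(n * 2 ^ n)])
     ((fun w => propagation_measure K beta s D X (fun i => Z i w) (cell n j)) @^-1`
      [set ((k j)%:R : R)%:E])); last first.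
    apply/seteqP; split => w /= h j; first by move=> _ /=; rewrite propagation_measureE.
    by have := h j I; rewrite /= propagation_measureE.
  apply: fin_bigcap_measurable => [|j _]; first exact: finite_finset.
  rewrite -[X in measurable X]setTI.
  apply: measurable_propagation_measure => //; exact: measurable_cell.
have AB w : is_lfcount (propagation_measure K beta s D X (fun i => Z i w)) -> A w <-> B w.
  move=> lf; have E B0 : propagation_process K beta (fun=> D) X Z s w B0 =
      propagation_measure K beta s D X (fun i => Z i w) B0.
    by rewrite propagation_processE indicE mem_set// mule1.
  split; first by move=> /cell_countsE h j; rewrite -propagation_measureE -E h.
  by move=> h; apply/cell_countsE => j; rewrite E propagation_measureE.
have [M [mM M0 hM]] := propagation_lf_ae D s.
have nM w : ~ M w -> is_lfcount (propagation_measure K beta s D X (fun i => Z i w)).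
  by move=> Mw; apply: contrapT => h; apply: Mw; exact: hM.
apply/eqP; rewrite eq_le; apply/andP; split.
  apply: (@le_trans _ _ (P (B `|` M))).
    apply: le_measure; rewrite ?inE//; first exact: measurableU.
    move=> w Aw; have [|/nM h] := pselect (M w); [by right|left]; exact/(AB _ h).
  apply: (@le_trans _ _ (P B + P M)%E); first exact: measureU2.
  by rewrite [X in (_ + X)%E](_ : _ = 0%E) ?adde0.
apply: (@le_trans _ _ (P (A `|` M))).
  apply: le_measure; rewrite ?inE//; first exact: measurableU.
  move=> w Aw; have [|/nM h] := pselect (M w); [by right|left]; exact/(AB _ h).
apply: (@le_trans _ _ (P A + P M)%E); first exact: measureU2.
by rewrite [X in (_ + X)%E](_ : _ = 0%E) ?adde0.
Qed.

Lemma cvg_propagation (D : R -> pred (R * R)) :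
  (\forall s \near +oo, forall i, D s (X i) -> X i != (0, 0)) ->
  (forall b b' e, 0 < b -> 0 < e -> \forall s \near +oo, forall r,
    expR (b * s ^+ 2) <= r -> r <= expR (b' * s ^+ 2) ->
    `|disk_num X (D s) r / r ^+ 2 - lambda * pi| <= e) ->
  cvg_in_law P (propagation_process K beta D X Z) P' N.
Proof.
move=> D0 DH; have [ppN _] := poissonN.
apply: cvg_in_law_cell_counts => //.
  by apply: nearW => s; exact: (propagation_point_process (D s) s).
move=> n k; rewrite poisson_cell_counts.
under eq_fun => s do rewrite (cell_counts_prob (D s) s k).
have [iZ _] := iidZ.
apply: (@null_array_cvg _ _ _ _ _ _ _ _ _
  (fun s i j => hit_set K beta X (D s) s (cell n (nat_of_ord j)) i)) => //.
- by move=> s i j; apply: measurable_hit_set => //; exact: measurable_cell.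
- move=> s i j1 j2 _ _ [z [[_ h1] [_ h2]]].
  by apply: (@trivIset_cell R n (n * 2 ^ n)) => //; exists (propagation K beta s (X i) z).
- move=> j.
  have [jb0 jb1] := (andP (cell_bounds R n j)).
  suff : mean_count K beta X (D s) s (cell n (nat_of_ord j)) @[s --> +oo] -->
      (fine (Lambda (cell n (nat_of_ord j))))%:E.
    apply: cvg_trans; apply: near_eq_cvg; apply: nearW => s.
    by apply: eq_eseriesr => i _; rewrite hit_probE//; exact: measurable_cell.
  (* A cell is the difference of two intervals [0, t[, where convergence is known; finite masses
     make the subtraction legitimate. *)
  have cm := cvg_mean_count K0 beta2 lambda0 lfX homX D0 DH.
  have cb := cm _ (le_trans jb0 jb1); have ca := cm _ jb0.
  rewrite /cell Lambda_itv ?cell_bounds//= EFinB.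
  have LE (t : R) : 0 <= t -> (lambda * pi / K ^+ 2 * t `^ (2 / beta))%:E =
     (fine (Lambda `[0%R, t[%classic))%:E by move=> t0; rewrite LambdaE.
  rewrite LE// in ca; rewrite LE ?(le_trans jb0)// in cb.
  apply: cvg_trans (cvgeB (fin_num_adde_defr _ _) cb ca) => //.
  apply: near_eq_cvg; apply: nearW => s /=.
  rewrite (mean_count_additive _ _ (cell_bounds R n j)) addeAC.
  have fa : mean_count K beta X (D s) s `[0%R, (j%:R * 2^-1 ^+ n)[%classic \is a fin_num.
    by rewrite ge0_fin_numE ?mean_count_ge0//; exact: (mean_count_lty _ _ lambda0).
  by rewrite subee// add0e.
- move=> e e0.
  (* All cells used at level n lie in [0, n[, so one bound covers every j. *)
  have := hit_prob_small K0 beta2 lfX n%:R D0 e0.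
  apply: filterS => s h i j; rewrite hit_probE; last exact: measurable_cell.
  apply: le_trans (h i); apply: le_measure; rewrite ?inE.
  - by apply: measurable_hit_set => //; exact: measurable_cell.
  - exact: measurable_hit_set.
  - move=> z [Dz]; rewrite /cell/= in_itv/= => /andP[h1 h2]; split => //=; rewrite in_itv/=.
    have /andP[jb0 _] := cell_bounds R n j.
    rewrite (le_trans jb0 h1)/=; apply: lt_le_trans h2 _.
    rewrite exprVn ler_pdivrMr ?exprn_gt0// -natrX -natrM ler_nat; exact: ltn_ord.
Qed.

End propagation_process.

(** * Homogeneity at radii exponential in sigma^2, for the plane and for the annulus *)

Section disk_num_asymptotics.
Variables (R : realType) (X : nat -> R * R) (lambda : R).
Hypotheses (lambda0 : 0 < lambda).
Hypotheses (lfX : locally_finite_pattern X) (homX : empirically_homogeneous lambda X).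

Lemma expR_sqr_near (b A : R) : 0 < b -> \forall s \near +oo, A <= expR (b * s ^+ 2).
Proof.
move=> b0; apply: filterS (near_sqr_ge A b0) => s /le_trans; apply.
by apply: le_trans (expR_ge1Dx _); rewrite lerDr.
Qed.

Lemma disk_num_predT_ratio (b e : R) : 0 < b -> 0 < e ->
  \forall s \near +oo, forall r, expR (b * s ^+ 2) <= r ->
    `|disk_num X predT r / r ^+ 2 - lambda * pi| <= e.
Proof.
move=> b0 e0; have [M [_ hM]] := disk_num_homogeneous lfX homX e0.
apply: filterS (expR_sqr_near (M + 1) b0) => s hs r hr.
have r0 : 0 < r by apply: lt_le_trans hr; exact: expR_gt0.
have r20 : 0 < r ^+ 2 by rewrite exprn_gt0.
have /hM : M < r by apply: lt_le_trans (le_trans hs hr); rewrite ltrDl.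
rewrite (_ : disk_num X predT r / r ^+ 2 - lambda * pi =
  (disk_num X predT r - lambda * pi * r ^+ 2) / r ^+ 2); last first.
  by rewrite mulrBl mulfK// gt_eqF.
by rewrite normrM (gtr0_norm (x := (r ^+ 2)^-1)) ?invr_gt0// ler_pdivrMr.
Qed.

Variables (a : R -> R) (b : R -> \bar R).
Hypothesis a_lne : (lne (a s)%:E * ((s ^+ 2)^-1)%:E)%E @[s --> +oo%R] --> 0%E.
Hypothesis b_lne : (lne (b s) * ((s ^+ 2)^-1)%:E)%E @[s --> +oo%R] --> +oo%E.

Lemma inner_radius_near (c : R) : 0 < c -> \forall s \near +oo, a s < expR (c * s ^+ 2).
Proof.
move=> c0; move/fine_cvgP : a_lne => [fin /cvgrPdist_lt/(_ _ c0)].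
move=> H; near=> s.
have s0 : 0 < s by near: s; exact: nbhs_pinfty_gt.
have s20 : 0 < s ^+ 2 by rewrite exprn_gt0.
(* [lne] is -oo at nonpositive arguments, so logarithms are taken only when a s > 0. *)
have [as0|as0] := leP (a s) 0; first exact: le_lt_trans as0 (expR_gt0 _).
have : `|0 - fine (lne (a s)%:E * ((s ^+ 2)^-1)%:E)%E| < c by near: s.
rewrite /= leNgt as0/= sub0r normrN => /(le_lt_trans (ler_norm _)).
by rewrite ltr_pdivrMr// => h; rewrite -[ltLHS]lnK ?posrE// ltr_expR.
Unshelve. all: by end_near.
Qed.

Lemma outer_radius_near (c : R) : \forall s \near +oo, ((expR (c * s ^+ 2))%:E < b s)%E.
Proof.
move/cvgeyPgt : b_lne => /(_ `|c|) H; near=> s.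
have s0 : 0 < s by near: s; exact: nbhs_pinfty_gt.
have s20 : 0 < s ^+ 2 by rewrite exprn_gt0.
have : (`|c|%:E < lne (b s) * ((s ^+ 2)^-1)%:E)%E by near: s.
case: (b s) => [r||] /=; [|by rewrite ltry|].
  case: ifPn => [r0|]; first by rewrite gt0_mulNye ?lte_fin ?invr_gt0.
  rewrite -ltNge => r0; rewrite -EFinM !lte_fin ltr_pdivlMr// => h.
  rewrite -[ltRHS]lnK ?posrE// ltr_expR; apply: le_lt_trans h.
  by rewrite ler_pM2r// ler_norm.
by rewrite gt0_mulNye ?lte_fin ?invr_gt0.
Unshelve. all: by end_near.
Qed.

(** The outer radius eventually exceeds every r in the range. The inner disk lies within radius exp
    (c s^2 / 2), so it removes O(exp (c s^2)) points, negligible against r^2 >= exp (2 c s^2). *)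
Lemma disk_num_annulus_ratio (c c' e : R) : 0 < c -> 0 < e ->
  \forall s \near +oo, forall r, expR (c * s ^+ 2) <= r -> r <= expR (c' * s ^+ 2) ->
    `|disk_num X (annulus a b s) r / r ^+ 2 - lambda * pi| <= e.
Proof.
move=> c0 e0; have e20 : 0 < e / 2 by rewrite divr_gt0.
have c20 : 0 < c / 2 by rewrite divr_gt0.
have [B B0 hB] := disk_num_growth lfX lambda0 homX.
near=> s; move=> r hr hr'.
have s0 : 0 < s by near: s; exact: nbhs_pinfty_gt.
have H1 : `|disk_num X predT r / r ^+ 2 - lambda * pi| <= e / 2.
  by move: r hr {hr'}; near: s; exact: disk_num_predT_ratio.
have H2 : a s < expR (c / 2 * s ^+ 2) by near: s; exact: inner_radius_near.
have H3 : ((expR (c' * s ^+ 2))%:E < b s)%E by near: s; exact: outer_radius_near.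
(* This gives B (1 + a'^2) <= 2 B a'^2 <= (e / 2) a'^4 <= (e / 2) r^2. *)
have H4 : 4 * B / e <= expR (c * s ^+ 2) by near: s; exact: expR_sqr_near.
have r0 : 0 < r by apply: lt_le_trans hr; exact: expR_gt0.
have r20 : 0 < r ^+ 2 by rewrite exprn_gt0.
set a' := expR (c / 2 * s ^+ 2) in H2.
have a'0 : 0 < a' by exact: expR_gt0.
have a'E : a' ^+ 2 = expR (c * s ^+ 2) by rewrite -expRM_natl; congr expR; field.
have a'1 : 1 <= a' ^+ 2 by rewrite a'E -expR0 ler_expR mulr_ge0 ?sqr_ge0// ltW.
have up : disk_num X (annulus a b s) r <= disk_num X predT r by exact: disk_num_le.
have lo : disk_num X predT r <= disk_num X (annulus a b s) r + disk_num X predT a'.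
  apply: disk_num_add => // i _ Xr.
  have [Xa|aX] := leP (enorm (X i)) (a s); first by right; rewrite (le_lt_trans Xa).
  left; split => //; rewrite /annulus lte_fin aX/=; apply: lt_trans H3.
  by rewrite lte_fin (lt_le_trans Xr).
have Ba : disk_num X predT a' <= e / 2 * r ^+ 2.
  apply: le_trans (hB _ a'0) _.
  have r2a : a' ^+ 2 * a' ^+ 2 <= r ^+ 2.
    by rewrite a'E -expr2 ler_sqr ?nnegrE ?(ltW r0)// ltW// expR_gt0.
  move: H4; rewrite ler_pdivrMr// -a'E; move: a'1 r2a {a'E H2}.
  move: (a' ^+ 2) (r ^+ 2) => q Q q1 qQ H4.
  have q0 : 0 <= q / 2 by rewrite divr_ge0// (le_trans ler01).
  have h1 := ler_wpM2l q0 H4; have h2 := ler_wpM2l (ltW e20) qQ.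
  have h3 : B * (1 + q) <= B * (2 * q) by rewrite ler_pM2l//; lra.
  lra.
have Ba2 : disk_num X predT a' / r ^+ 2 <= e / 2 by rewrite ler_pdivrMr.
have up2 : disk_num X (annulus a b s) r / r ^+ 2 <= disk_num X predT r / r ^+ 2.
  by rewrite ler_pM2r// invr_gt0.
have lo2 : disk_num X predT r / r ^+ 2 <=
    disk_num X (annulus a b s) r / r ^+ 2 + disk_num X predT a' / r ^+ 2.
  by rewrite -mulrDl ler_pM2r// invr_gt0.
move: H1; rewrite !ler_norml => /andP[? ?]; apply/andP; split; lra.
Unshelve. all: by end_near.
Qed.

End disk_num_asymptotics.


Unset Implicit Arguments.

Theorem theorem3 (R : realType)
  (d : measure_display) (Omega : measurableType d) (P : probability Omega R)
  (lambda K beta : R) (X : nat -> R * R) (Z : nat -> {RV P >-> R})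
  (Lambda : {measure set R -> \bar R})
  (d' : measure_display) (Omega' : measurableType d')
  (P' : probability Omega' R) (N : Omega' -> lfcount R) :
  0 < lambda -> 0 < K -> 2 < beta ->
  locally_finite_pattern X ->
  empirically_homogeneous lambda X ->
  iid_standard_normal Z ->
  (forall t : R, 0 <= t ->
     Lambda `[0, t[%classic = (lambda * pi / K ^+ 2 * t `^ (2 / beta))%:E) ->
  poisson_process P' N Lambda ->
  ((forall sigma : R, 0 < sigma ->
      point_process (propagation_process K beta (fun=> predT) X Z sigma) /\
      {ae P, forall w, is_lfcount
         (propagation_measure K beta sigma predT X (fun i => Z i w))}) /\
   ((forall i, X i != (0, 0)) ->
      cvg_in_law P (propagation_process K beta (fun=> predT) X Z) P' N)) /\
  (forall (a : R -> R) (b : R -> \bar R),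
     (forall sigma : R, 0 < sigma ->
        0 <= a sigma /\ ((a sigma)%:E < b sigma)%E) ->
     (lne (a sigma)%:E * ((sigma ^+ 2)^-1)%:E)%E @[sigma --> +oo%R] --> 0%E ->
     (lne (b sigma) * ((sigma ^+ 2)^-1)%:E)%E @[sigma --> +oo%R] --> +oo%E ->
     (forall sigma : R, 0 < sigma ->
        point_process (propagation_process K beta (annulus a b) X Z sigma) /\
        {ae P, forall w, is_lfcount
           (propagation_measure K beta sigma (annulus a b sigma) X
              (fun i => Z i w))}) /\
     cvg_in_law P (propagation_process K beta (annulus a b) X Z) P' N).
Proof.
move=> lambda0 K0 beta2 lfX homX iidZ LambdaE poissonN; split; [split|].
- move=> s _; split; first exact: propagation_point_process.
  exact: (propagation_lf_ae K0 beta2 lambda0 lfX homX iidZ).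
- move=> X0; apply: (cvg_propagation K0 beta2 lambda0 lfX homX iidZ LambdaE poissonN).
    by apply: nearW => s i _; exact: X0.
  move=> b b' e b0 e0; apply: filterS (disk_num_predT_ratio lfX homX b0 e0) => s h r hr _.
  exact: h.
- move=> a b ab a_lne b_lne; split.
    move=> s _; split; first exact: (propagation_point_process _ _ _ _ (annulus a b s)).
    exact: (propagation_lf_ae K0 beta2 lambda0 lfX homX iidZ (annulus a b s)).
  apply: (cvg_propagation K0 beta2 lambda0 lfX homX iidZ LambdaE poissonN).
    (* The strict inequality at the inner radius, with a s >= 0, discards the origin. *)
    apply: filterS (nbhs_pinfty_gt (num_real 0)) => s /ab[a0 _] i /andP[aX _].
    by rewrite -enorm_eq0 gt_eqF// (le_lt_trans a0)// -lte_fin.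
  by move=> c c' e c0 e0; exact: (disk_num_annulus_ratio lambda0 lfX homX a_lne b_lne).
Qed.
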